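(* Let $P$ be a torsion-free complex. For every $n\in\mathbb{N}$, the $(n+1)$-functor $\mathrm{ev}^n$ is an isomorphism between the free extension $\mathrm{Cell}(P)_{\le n}[P_{n+1}]$ and the $(n+1)$-category $\mathrm{Cell}(P)_{\le n+1}$.
   Context: An $\omega$-hypergraph is a set $P$ with a partition $P=\bigsqcup_{n\in\mathbb{N}}P_n$ together with, for $n\in\mathbb{N}$ and $u\in P_{n+1}$, two finite subsets $u^-,u^+\subseteq P_n$. For $U\subseteq P$ and $\epsilon\in\{-,+\}$, $U^\epsilon=\bigcup_{u\in U}u^\epsilon$; also $U^\mp=U^-\setminus U^+$ and $U^\pm=U^+\setminus U^-$. A subset $U\subseteq P_n$ is fork-free if either $n=0$ and $|U|=1$, or $n>0$ and $u^\epsilon\cap v^\epsilon=\emptyset$ for all distinct $u,v\in U$ and all $\epsilon\in\{-,+\}$. For $U\subseteq P_n$, $\triangleleft_U$ is the transitive closure of the relation on $U$ relating $u$ to $v$ when $n\ge 1$ and $u^+\cap v^-\neq\emptyset$; for $V,W\subseteq U$, $V\triangleleft_U W$ means $v\triangleleft_U w$ for some $v\in V$, $w\in W$; a subset $V\subseteq U$ is a segment for $\triangleleft_U$ if $u_1,u_3\in V$ and $u_1\triangleleft_U u_2\triangleleft_U u_3$ imply $u_2\in V$. An $n$-pre-cell of $P$ is a tuple $X=(X_{0,-},X_{0,+},\ldots,X_{n-1,-},X_{n-1,+},X_n)$ of finite subsets $X_{i,\epsilon}\subseteq P_i$, $X_n\subseteq P_n$; one writes $X_{n,-}=X_{n,+}=X_n$.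 For $i<n$, $\partial^\epsilon_i X=(X_{0,-},X_{0,+},\ldots,X_{i-1,-},X_{i-1,+},X_{i,\epsilon})$. A finite set $M\subseteq P_{i+1}$ moves a finite $U\subseteq P_i$ to a finite $V\subseteq P_i$ if $U=(V\cup M^-)\setminus M^+$ and $V=(U\cup M^+)\setminus M^-$. An $n$-cell is an $n$-pre-cell such that $X_{i+1,\epsilon}$ moves $X_{i,-}$ to $X_{i,+}$ for $0\le i<n$, $\epsilon\in\{-,+\}$, and every $X_{i,\epsilon}$ ($0\le i\le n$) is fork-free. $\mathrm{Cell}(P)$ is the graded set of cells. Operations: for an $n$-cell $X$, $\mathrm{id}^{n+1}(X)=(X_{0,-},X_{0,+},\ldots,X_{n-1,-},X_{n-1,+},X_n,X_n,\emptyset)$. For $i<n$ and $n$-cells $X,Y$ with $\partial^+_iX=\partial^-_iY$, $X\ast_iY$ is the $n$-pre-cell $Z$ with $Z_{j,\epsilon}=X_{j,\epsilon}$ for $j<i$, $Z_{i,-}=X_{i,-}$, $Z_{i,+}=Y_{i,+}$, and $Z_{j,\epsilon}=X_{j,\epsilon}\cup Y_{j,\epsilon}$ for $j>i$. For $u\in P_n$, the atom $\langle u\rangle$ is the $n$-pre-cell with $\langle u\rangle_{n,-}=\langle u\rangle_{n,+}=\{u\}$ and, for $j<n$, $\langle u\rangle_{j,-}=(\langle u\rangle_{j+1,-})^\mp$, $\langle u\rangle_{j,+}=(\langle u\rangle_{j+1,+})^\pm$. $P$ is a torsion-free complex if it satisfies: (non-emptiness) $u^-\ne\emptyset$ and $u^+\neq\emptyset$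 for all $u\in P_n$, $n\ge1$; (acyclicity) $\triangleleft_{P_n}$ is irreflexive for all $n\geq 1$; (relevance) $\langle u\rangle$ is a cell for all $u\in P$; (segment) for all $k\in\mathbb N$, $u\in P_k$, $n<k$, every $n$-cell $X$ and $\epsilon\in\{-,+\}$, if $\langle u\rangle_{n,\epsilon}\subseteq X_n$ then $\langle u\rangle_{n,\epsilon}$ is a segment for $\triangleleft_{X_n}$; (torsion-freeness) there are no $n,k,l\ge1$ with $n<\min(k,l)$, $u\in P_k$, $v\in P_l$ and $n$-cell $X$ with $\langle u\rangle_{n,+}\subseteq X_n$, $\langle v\rangle_{n,-}\subseteq X_n$, $\langle u\rangle_{n,+}\cap\langle v\rangle_{n,-}=\emptyset$, $\langle u\rangle_{n,+}\triangleleft_{X_n}\langle v\rangle_{n,-}$ and $\langle v\rangle_{n,-}\triangleleft_{X_n}\langle u\rangle_{n,+}$. For a torsion-free complex $P$, $\mathrm{Cell}(P)$ with source and target operations $\partial^-_i,\partial^+_i$, identities $X\mapsto\mathrm{id}^{n+1}(X)$ and compositions $(X,Y)\mapsto X\ast_iY$ is a strict $\omega$-category; $\mathrm{Cell}(P)_{\le n}$ denotes its truncation to a strict $n$-category (forgetting cells of dimension $>n$). Free extensions: an $n$-cellular extension is a pair $(C,S)$ of a strict $n$-category $C$ and a set $S$ with functions $d^-_n,d^+_n\colon S\to C_n$ such that, when $n>0$, $\partial^\epsilon_{n-1}\circ d^-_n=\partial^\epsilon_{n-1}\circ d^+_n$ for $\epsilon\in\{-,+\}$. The free extension $C[S]$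 is the strict $(n+1)$-category with $n$-truncation $C$ and a map $S\to C[S]_{n+1}$ compatible with sources and targets (elements of $S$ being identified with their images), universal in the sense that for every strict $(n+1)$-category $D$, $n$-functor $F\colon C\to D_{\le n}$ and function $f\colon S\to D_{n+1}$ with $\partial^\epsilon_n f(s)=F(d^\epsilon_n(s))$, there is a unique $(n+1)$-functor $C[S]\to D$ restricting to $F$ and $f$. The pair $(\mathrm{Cell}(P)_{\le n},P_{n+1})$ is an $n$-cellular extension with $d^\epsilon_n(x)=\partial^\epsilon_n\langle x\rangle$ for $x\in P_{n+1}$. The $(n+1)$-functor $\mathrm{ev}^n\colon \mathrm{Cell}(P)_{\le n}[P_{n+1}]\to\mathrm{Cell}(P)_{\le n+1}$ is the unique one which is the identity on $\mathrm{Cell}(P)_{\le n}$ and sends each generator $g\in P_{n+1}$ to the atom $\langle g\rangle$. *)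

(* Defs.v *)
(* MathComp with finmap (finite subsets) and boolp (classical logic). *)
From Stdlib Require Import Relation_Operators.
From mathcomp Require Import all_boot finmap boolp.

Set Implicit Arguments.
Unset Strict Implicit.
Unset Printing Implicit Defensive.

Inductive sign := Neg | Pos.

(** * Strict categories *)

(* A dimension is [Some n] for n-categories and [None] for omega-categories. *)
Definition below (N : option nat) (k : nat) : bool :=
  if N is Some n then k <= n else true.

(* [bd e H] is the boundary operation of sign e from dimension k to dimension i,
   for H : i < k.  [ccomp i x y] is the composite along the i-boundary of two
   k-cells (x first); it is a total function whose value is only meaningful on
   pairs with [composable]. *)
Record cat_data (N : option nat) := CatData {
  cells :> nat -> Type;
  bd : sign -> forall i k, i < k -> cells k -> cells i;
  idc : forall k, below N k.+1 -> cells k -> cells k.+1;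
  ccomp : nat -> forall k, cells k -> cells k -> cells k
}.

Arguments bd {N c} e {i k} H x.
Arguments idc {N c k} H x.
Arguments ccomp {N c} i {k} x y.

Definition composable N (C : cat_data N) i k (H : i < k) (x y : C k) : Prop :=
  bd Pos H x = bd Neg H y.

Lemma belowW N k : below N k.+1 -> below N k.
Proof. by case: N => //= n; apply: ltnW. Qed.

(* The (d + i)-dimensional iterated identity of an i-cell. *)
Fixpoint idcn N (C : cat_data N) i d : below N (d + i) -> C i -> C (d + i) :=
  match d with
  | 0 => fun _ x => x
  | d'.+1 => fun H x => idc H (idcn (belowW H) x)
  end.

Record is_strict_cat N (C : cat_data N) : Prop := IsStrictCat {
  cells_below : forall k, C k -> below N k;
  bd_bd : forall e e' i j k (Hij : i < j) (Hjk : j < k) (Hik : i < k) (x : C k),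
    bd e Hij (bd e' Hjk x) = bd e Hik x;
  bd_idc : forall e k (H : below N k.+1) (Hk : k < k.+1) (x : C k),
    bd e Hk (idc H x) = x;
  bd_ccomp_src : forall i k (H : i < k) (x y : C k), composable H x y ->
    bd Neg H (ccomp i x y) = bd Neg H x;
  bd_ccomp_tgt : forall i k (H : i < k) (x y : C k), composable H x y ->
    bd Pos H (ccomp i x y) = bd Pos H y;
  bd_ccomp : forall e i j k (Hij : i < j) (Hjk : j < k) (Hik : i < k) (x y : C k),
    composable Hik x y ->
    bd e Hjk (ccomp i x y) = ccomp i (bd e Hjk x) (bd e Hjk y);
  ccomp_idl : forall i d (H : i < d + i) (Hd : below N (d + i)) (x : C (d + i)),
    ccomp i (idcn Hd (bd Neg H x)) x = x;
  ccomp_idr : forall i d (H : i < d + i) (Hd : below N (d + i)) (x : C (d + i)),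
    ccomp i x (idcn Hd (bd Pos H x)) = x;
  ccompA : forall i k (H : i < k) (x y z : C k),
    composable H x y -> composable H y z ->
    ccomp i (ccomp i x y) z = ccomp i x (ccomp i y z);
  ccomp_exchange : forall i j k (Hij : i < j) (Hjk : j < k) (Hik : i < k)
      (x x' y y' : C k),
    composable Hjk x x' -> composable Hjk y y' -> composable Hik x y ->
    ccomp i (ccomp j x x') (ccomp j y y') = ccomp j (ccomp i x y) (ccomp i x' y');
  idc_ccomp : forall i k (H : i < k) (Hk : below N k.+1) (x y : C k),
    composable H x y -> idc Hk (ccomp i x y) = ccomp i (idc Hk x) (idc Hk y)
}.

(* Forgetting the cells of dimension > n. *)
Section Truncation.
Variables (N : option nat) (C : cat_data N) (n : nat) (Hn : below N n).

Let cell_le k := {x : C k | k <= n}.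

Lemma below_le k : k <= n -> below N k.
Proof. by case: N Hn => //= m Hm Hk; apply: leq_trans Hk Hm. Qed.

Definition trunc : cat_data (Some n) := {|
  cells := cell_le;
  bd := fun e i k (H : i < k) (x : cell_le k) =>
    exist _ (bd e H (val x)) (leq_trans (ltnW H) (valP x));
  idc := fun k (H : below (Some n) k.+1) (x : cell_le k) =>
    exist _ (idc (below_le H) (val x)) H;
  ccomp := fun i k (x y : cell_le k) =>
    exist _ (ccomp i (val x) (val y)) (valP x)
|}.
End Truncation.
Arguments trunc {N} C {n} Hn.

(* The n-truncation of an (n+1)-category. *)
Notation truncS D := (@trunc (Some _.+1) D _ (leqnSn _)).

Record is_functor N (C D : cat_data N) (F : forall k, C k -> D k) : Prop :=
  IsFunctor {
    functor_bd : forall e i k (H : i < k) (x : C k),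
      F i (bd e H x) = bd e H (F k x);
    functor_idc : forall k (H : below N k.+1) (x : C k),
      F k.+1 (idc H x) = idc H (F k x);
    functor_ccomp : forall i k (H : i < k) (x y : C k), composable H x y ->
      F k (ccomp i x y) = ccomp i (F k x) (F k y)
  }.

Definition is_isomorphism N (C D : cat_data N) (F : forall k, C k -> D k) : Prop :=
  is_functor F /\
  exists2 G : forall k, D k -> C k, is_functor G &
    forall k, cancel (F k) (G k) /\ cancel (G k) (F k).

(** * Free extensions *)

Record extension_data (n : nat) := ExtensionData {
  ext_cat : cat_data (Some n);
  ext_gen : Type;
  ext_bd : sign -> ext_gen -> ext_cat n
}.

Definition is_cellular_extension n (X : extension_data n) : Prop :=
  is_strict_cat (ext_cat X) /\
  forall e m (H : m < n) (s : ext_gen X), n = m.+1 ->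
    bd e H (ext_bd Neg s) = bd e H (ext_bd Pos s).

(* An (n+1)-category receiving the n-category and the generators of X; the
   n-category is mapped to the n-truncation. *)
Record cocone n (X : extension_data n) := Cocone {
  cc_cat : cat_data (Some n.+1);
  cc_inc : forall k, ext_cat X k -> truncS cc_cat k;
  cc_gen : ext_gen X -> cc_cat n.+1
}.

Record is_cocone n (X : extension_data n) (E : cocone X) : Prop := IsCocone {
  cc_strict : is_strict_cat (cc_cat E);
  cc_functor : is_functor (@cc_inc n X E);
  cc_gen_bd : forall e (s : ext_gen X),
    bd e (ltnSn n) (cc_gen E s) = val (cc_inc E (ext_bd e s))
}.

Definition is_cocone_map n (X : extension_data n) (E D : cocone X)
    (G : forall k, cc_cat E k -> cc_cat D k) : Prop :=
  [/\ is_functor G,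
      forall k (x : ext_cat X k), G k (val (cc_inc E x)) = val (cc_inc D x)
    & forall s : ext_gen X, G n.+1 (cc_gen E s) = cc_gen D s].

(* That the n-truncation of the free extension is C is expressed by requiring
   that the structural functor from C to the truncation be an isomorphism. *)
Definition is_free_extension n (X : extension_data n) (E : cocone X) : Prop :=
  [/\ is_cocone E,
      is_isomorphism (@cc_inc n X E)
    & forall D : cocone X, is_cocone D ->
        exists! G : forall k, cc_cat E k -> cc_cat D k, is_cocone_map G].

(** * Hypergraphs *)

Local Open Scope fset_scope.
Local Open Scope nat_scope.

(* The partition of P is given by the function [hdim].  The sets [hbd e u] are
   the u^e; by [hbd_dim] they are empty when u has dimension 0. *)
Record hypergraph := Hypergraph {
  hset :> choiceType;
  hdim : hset -> nat;
  hbd : sign -> hset -> {fset hset};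
  hbd_dim : forall e u v, v \in hbd e u -> hdim u = (hdim v).+1
}.

Section Hypergraph.
Variable P : hypergraph.
Implicit Types (U V W M : {fset P}) (u v : P) (e : sign).

Definition hbdU e U : {fset P} := \bigcup_(u <- U) hbd e u.

(* U^{-+} for e = Neg and U^{+-} for e = Pos. *)
Definition hbd_strict e U : {fset P} :=
  match e with
  | Neg => hbdU Neg U `\` hbdU Pos U
  | Pos => hbdU Pos U `\` hbdU Neg U
  end.

(* For U a subset of P_n. *)
Definition fork_free (n : nat) U : Prop :=
  if n is 0 then #|` U| = 1
  else forall u v, u \in U -> v \in U -> u <> v ->
    forall e, hbd e u `&` hbd e v = fset0.

Definition tri (U : {pred P}) : P -> P -> Prop :=
  clos_trans P (fun u v => [/\ u \in U, v \in U & hbd Pos u `&` hbd Neg v != fset0]).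

Definition tri_sets (U : {pred P}) V W : Prop :=
  exists v w, [/\ v \in V, w \in W & tri U v w].

Definition segment (U : {pred P}) V : Prop :=
  forall u1 u2 u3, u1 \in V -> u3 \in V -> tri U u1 u2 -> tri U u2 u3 -> u2 \in V.

Definition moves M U V : Prop :=
  U = (V `|` hbdU Neg M) `\` hbdU Pos M /\
  V = (U `|` hbdU Pos M) `\` hbdU Neg M.

(* The tuple (X_{0,-}, X_{0,+}, ..., X_n) is encoded as the function sending
   (i, e) to X_{i,e}, with X_{n,-} = X_{n,+} = X_n, extended by the empty set
   in dimensions > n. *)
Definition layers := nat -> sign -> {fset P}.
Implicit Types X Y : layers.

Definition is_precell (n : nat) X : Prop :=
  [/\ forall i e u, u \in X i e -> hdim u = i,
      X n Neg = X n Pos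
    & forall i e, n < i -> X i e = fset0].

Definition is_cell (n : nat) X : Prop :=
  [/\ is_precell n X,
      forall i e, i < n -> moves (X i.+1 e) (X i Neg) (X i Pos)
    & forall i e, i <= n -> fork_free i (X i e)].

Definition layers_bd e (i : nat) X : layers := fun j e' =>
  if j < i then X j e' else if j == i then X j e else fset0.

Definition layers_comp (i : nat) X Y : layers := fun j e =>
  if j < i then X j e
  else if j == i then (if e is Neg then X j Neg else Y j Pos)
  else X j e `|` Y j e.

Definition cell (n : nat) := {X : layers | `[< is_cell n X >]}.

Lemma is_cell_bd e i k X : i < k -> is_cell k X -> is_cell i (layers_bd e i X).
Proof.
move=> ik [[Xd Xn X0] Xm Xf]; split; first split.
- move=> j e' u; rewrite /layers_bd; case: ifP => _; first exact: Xd.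
  by case: ifP => // _; apply: Xd.
- by rewrite /layers_bd ltnn eqxx.
- by move=> j e' ij; rewrite /layers_bd ltnNge (ltnW ij) gtn_eqF.
- move=> j e' ji; rewrite /layers_bd ji.
  have jk := ltn_trans ji ik.
  case: (ltngtP j.+1 i) ji => [_ _|//|_ _].
  + exact: Xm.
  + exact: Xm.
- move=> j e' ji; have jk := leq_trans ji (ltnW ik).
  rewrite /layers_bd; case: (ltngtP j i) ji => [_ _|//|_ _]; exact: Xf.
Qed.

(* With the encoding above, the layers of id^{n+1}(X) are those of X. *)
Lemma is_cell_id k X : is_cell k X -> is_cell k.+1 X.
Proof.
move=> [[Xd Xn X0] Xm Xf]; split; first split => //.
- by rewrite !X0.
- by move=> i e ki; apply: X0; apply: ltnW.
- move=> i e; rewrite ltnS leq_eqVlt => /orP[/eqP->|]; last exact: Xm.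
  have h e' : hbdU e' fset0 = fset0 by rewrite /hbdU big_seq_fset0.
  by rewrite X0 // /moves !h !fsetD0 !fsetU0 Xn.
- move=> i e; rewrite leq_eqVlt => /orP[/eqP->|]; last exact: Xf.
  by rewrite X0 // => u v; rewrite in_fset0.
Qed.

Definition CellCat : cat_data None := {|
  cells := cell;
  bd := fun e i k (H : i < k) (X : cell k) =>
    exist _ (layers_bd e i (val X)) (asboolT (is_cell_bd e H (asboolW (valP X))));
  idc := fun k _ (X : cell k) =>
    exist _ (val X) (asboolT (is_cell_id (asboolW (valP X))));
  ccomp := fun i k (X Y : cell k) => insubd X (layers_comp i (val X) (val Y))
|}.

Definition CellLe (n : nat) : cat_data (Some n) := @trunc None CellCat n isT.

Definition atom u : layers := fun j e =>
  if j <= hdim u then iter (hdim u - j) (hbd_strict e) [fset u] else fset0.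

(* The component X_n of an n-cell. *)
Definition top n (X : cell n) : {fset P} := val X n Neg.

Record torsion_free : Prop := TorsionFree {
  tf_nonempty : forall e u, 1 <= hdim u -> hbd e u != fset0;
  tf_acyclic : forall n u, 1 <= n -> ~ tri [pred v | hdim v == n] u u;
  tf_relevance : forall u, is_cell (hdim u) (atom u);
  tf_segment : forall u n (X : cell n) e, n < hdim u ->
    atom u n e `<=` top X -> segment (mem (top X)) (atom u n e);
  tf_torsion : ~ exists n u v (X : cell n),
    [/\ 1 <= n, n < minn (hdim u) (hdim v)
      & [/\ atom u n Pos `<=` top X, atom v n Neg `<=` top X,
            atom u n Pos `&` atom v n Neg = fset0,
            tri_sets (mem (top X)) (atom u n Pos) (atom v n Neg)
          & tri_sets (mem (top X)) (atom v n Neg) (atom u n Pos)]]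
}.

Hypothesis tf : torsion_free.

Definition gens (n : nat) := {u : P | hdim u == n}.

Lemma atom_is_cell n (g : gens n) : is_cell n (atom (val g)).
Proof. by have := tf_relevance tf (val g); rewrite (eqP (valP g)). Qed.

Definition atom_cell n (g : gens n) : cell n :=
  exist _ (atom (val g)) (asboolT (atom_is_cell g)).

(* The pair (Cell(P)_{<=n}, P_{n+1}), with d^e(g) the n-boundary of <g>. *)
Definition CellExt (n : nat) : extension_data n := {|
  ext_cat := CellLe n;
  ext_gen := gens n.+1;
  ext_bd := fun e g =>
    exist _ (@bd None CellCat e n n.+1 (ltnSn n) (atom_cell g)) (leqnn n)
|}.

(* Cell(P)_{<=n+1} with the inclusion of Cell(P)_{<=n} and the atoms. *)
Definition CellCocone (n : nat) : cocone (CellExt n) :=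
  @Cocone n (CellExt n) (CellLe n.+1)
    (fun k (X : CellLe n k) => exist _ (exist _ (val X) (leqW (valP X))) (valP X))
    (fun g => exist _ (atom_cell g) (leqnn n.+1)).

End Hypergraph.

(* Main.v *)
(* Gluing.  If T is the top of an n-cell, dim u > n and <u>_{n,e} is contained in T,
   then replacing <u>_{n,e} by <u>_{n,-e} in T gives an n-cell again, and <u>_{n,-e} is
   disjoint from T.  This goes by induction on n: by the segment axiom the cell can be cut
   around <u>_{n,e}, and <u>_{n,-} and <u>_{n,+} have the same effect on (n-1)-cells.
   It follows that gluing a fork-free set on a cell gives a cell, that sets glued one
   after the other do not interact badly, and hence that composites of cells are cells.

   Freeness.  It is enough that Cell(P)_{<=n+1} itself has the universal property of the
   free extension.  Given a cocone D, an (n+1)-cell decomposes along dimension n into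
   "items", which have one generator g on top; an item whose layers above dimension i+1
   are those of <g> is a composite u *_i x *_i v with u and v of dimension i+1 and
   x an item whose layers above dimension i are those of <g>, and in dimension 0 only <g>
   itself is left.  This determines the value of a cell in D.  Two decompositions differ by
   moves of elements past each other, and torsion-freeness allows every such move to be
   realized by the exchange law one dimension lower, so that the value is well defined. *)
Require Import Defs.
From Stdlib Require Import Relation_Operators.
From mathcomp Require Import all_boot finmap boolp.

Set Implicit Arguments.
Unset Strict Implicit.
Unset Printing Implicit Defensive.

Local Open Scope fset_scope.
Local Open Scope nat_scope.

(** The segment axiom allows a cut around an atom, but elements incomparable with the atom may go on
    either side of it, so a decomposition into items is a choice. Evaluation in D is therefore first
    a relation ([Ev], [EvT]) between cells and values, shown to be total and then functional. It is
    carried by pairs of a cell and a value with matching boundaries ([lies_over]): composability in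
    D is then read off from equalities between finite sets, and the laws of a strict category can be
    applied to pairs. Exchange and functionality are interleaved along the dimension. To exchange
    two neighbours in dimension i they must be recognized as whiskered items, which uses
    functionality in dimension i. Functionality in dimension i+1 follows from such exchanges, each
    of which lowers the number of elements that two decompositions place on different sides. *)

Ltac fset_hyp H z :=
  move: (f_equal (fun S : {fset _} => z \in S) H) => /=; clear H.

Ltac fset_hyps z :=
  repeat match goal with
  | H : is_true (?A `<=` ?B) |- _ => move: (fsubsetP H z); clear H
  | H : @eq (@finset_of _ _) ?A ?B |- _ => fset_hyp H z
  | H : @eq (finSet _) ?A ?B |- _ => fset_hyp H z
  end.

Ltac fset_bool :=
  rewrite ?(in_fsetU, in_fsetI, in_fsetD, in_fset0) /=;
  repeat match goal with |- context [?z \in ?A] => case: (z \in A) => /= end;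
  intros; repeat match goal with H : is_true true -> _ |- _ => specialize (H isT) end;
  try done.

(* Decides the consequences, in the boolean algebra of finite sets, of the
   equations and inclusions in the context. *)
Ltac fset_solve :=
  match goal with
  | |- is_true (_ `<=` _) => apply/fsubsetP; let z := fresh "z" in
      move=> z; apply/implyP; fset_hyps z; fset_bool
  | |- @eq _ _ _ => apply/fsetP; let z := fresh "z" in
      move=> z; fset_hyps z; fset_bool
  end.

Definition opp_sign (e : sign) : sign := if e is Neg then Pos else Neg.

(** * Gluing generators on cells *)

Section Combinatorics.
Variable P : hypergraph.
Implicit Types (S T U V W G : {fset P}) (u v w x y g h : P) (e : sign) (X Y A B : layers P).

Lemma hbdUP e U z : reflect (exists2 u, u \in U & z \in hbd e u) (z \in hbdU e U).
Proof.
rewrite /hbdU; apply: (iffP (bigfcupP _ _ _ _)) => [[u /andP[uU _] zu]|[u uU zu]]; exists u => //.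
by rewrite uU.
Qed.

Lemma hbdUU e U V : hbdU e (U `|` V) = hbdU e U `|` hbdU e V.
Proof.
apply/fsetP => z; rewrite in_fsetU; apply/hbdUP/orP.
  by move=> [u /fsetUP[] uU zu]; [left|right]; apply/hbdUP; exists u.
by move=> [] /hbdUP[u uU zu]; exists u => //; apply/fsetUP; [left|right].
Qed.

Lemma hbdU0 e : hbdU e fset0 = fset0 :> {fset P}.
Proof. by rewrite /hbdU big_seq_fset0. Qed.

Lemma hbdU1 e u : hbdU e [fset u] = hbd e u.
Proof. by rewrite /hbdU big_seq_fset1. Qed.

Lemma hbd_strictE e U : hbd_strict e U = hbdU e U `\` hbdU (opp_sign e) U.
Proof. by case: e. Qed.

Definition arrow x y : bool := hbd Pos x `&` hbd Neg y != fset0.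

Lemma arrowP x y : reflect (exists2 z, z \in hbd Pos x & z \in hbd Neg y) (arrow x y).
Proof.
apply: (iffP (fset0Pn _)) => [[z /fsetIP[]]|[z zx zy]]; first by exists z.
by exists z; apply/fsetIP.
Qed.

Definition prec : P -> P -> Prop := clos_trans P arrow.

Lemma arrow_hdim x y : arrow x y -> hdim x = hdim y /\ 1 <= hdim x.
Proof. by move=> /arrowP[z /hbd_dim -> /hbd_dim ->]. Qed.

Lemma prec_hdim x y : prec x y -> hdim x = hdim y.
Proof.
by elim=> {x y} [x y /arrow_hdim[]|x y z _ -> _ ->].
Qed.

(** Separating the top [T] from the lower layers [A] allows gluing to vary the top of a cell while
    its boundary stays literally fixed. *)
Definition with_top n A T : layers P :=
  fun j e => if j < n then A j e else if j == n then T else fset0.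

Lemma with_top_lt n A T j e : j < n -> with_top n A T j e = A j e.
Proof. by rewrite /with_top => ->. Qed.

Lemma with_topE n A T e : with_top n A T n e = T.
Proof. by rewrite /with_top ltnn eqxx. Qed.

Lemma with_top_gt n A T j e : n < j -> with_top n A T j e = fset0.
Proof. by move=> nj; rewrite /with_top ltnNge (ltnW nj) gtn_eqF. Qed.

Lemma eq_with_top n A B T : (forall j e, j < n -> A j e = B j e) ->
  with_top n A T = with_top n B T.
Proof.
move=> AB; apply: functional_extensionality_dep => j.
apply: functional_extensionality_dep => e.
by rewrite /with_top; case: ifP => // jn; apply: AB.
Qed.

Lemma with_top_id n X e : is_cell n X -> with_top n X (X n e) = X.
Proof.
move=> [[_ Xn X0] _ _]; apply: functional_extensionality_dep => j.
apply: functional_extensionality_dep => e'.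
rewrite /with_top; case: ltngtP => [//|/X0->//|->].
by case: e e' => [] [].
Qed.

(* A gluable set G turns the top T of an n-cell into [act G T]. *)
Definition gluable n T G : Prop :=
  [/\ forall u, u \in G -> hdim u = n.+1, fork_free n.+1 G
    & hbd_strict Neg G `<=` T].

Definition act G T : {fset P} := (T `|` hbdU Pos G) `\` hbdU Neg G.

Lemma fork_freeS n G : fork_free n.+1 G <->
  forall u v e z, u \in G -> v \in G -> z \in hbd e u -> z \in hbd e v -> u = v.
Proof.
split=> /= ffG u v.
  move=> e z uG vG zu zv; apply: contrapT => uv.
  have := ffG _ _ uG vG uv e; move/fsetP/(_ z).
  by rewrite in_fsetI zu zv.
move=> uG vG uv e; apply/fsetP => z; rewrite in_fsetI in_fset0.
apply/negP => /andP[zu zv]; exact: uv (ffG u v e z uG vG zu zv).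
Qed.

Lemma fork_free_sub n G G' : G' `<=` G -> fork_free n.+1 G -> fork_free n.+1 G'.
Proof.
move=> /fsubsetP sG /fork_freeS ffG; apply/fork_freeS => u v e z uG vG.
by apply: ffG; apply: sG.
Qed.

Lemma fork_free_disj n G G1 G2 e : fork_free n.+1 G -> G1 `<=` G -> G2 `<=` G ->
  G1 `&` G2 = fset0 -> hbdU e G1 `&` hbdU e G2 = fset0.
Proof.
move=> /fork_freeS ffG /fsubsetP s1 /fsubsetP s2 /fsetP d12.
apply/fsetP => z; rewrite in_fsetI in_fset0; apply/negP.
move=> /andP[/hbdUP[u u1 zu] /hbdUP[v v2 zv]].
have uv := ffG _ _ _ _ (s1 _ u1) (s2 _ v2) zu zv; subst v.
by have := d12 u; rewrite in_fsetI u1 v2.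
Qed.

Lemma fork_freeU n G1 G2 : fork_free n.+1 G1 -> fork_free n.+1 G2 ->
  (forall e, hbdU e G1 `&` hbdU e G2 = fset0) -> fork_free n.+1 (G1 `|` G2).
Proof.
move=> /fork_freeS ff1 /fork_freeS ff2 d12; apply/fork_freeS => u v e z.
have F a b : a \in G1 -> b \in G2 -> z \in hbd e a -> z \in hbd e b -> a = b.
  move=> a1 b2 za zb; have /fsetP/(_ z) := d12 e; rewrite in_fsetI in_fset0.
  by move=> /negP[]; apply/andP; split; apply/hbdUP; [exists a|exists b].
move=> /fsetUP[] uG /fsetUP[] vG zu zv.
- exact: (ff1 _ _ e z).
- exact: F.
- exact/esym/F.
- exact: (ff2 _ _ e z).
Qed.

Definition mk_cell n X (h : is_cell n X) : cell P n := exist _ X (asboolT h).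

Hypothesis tf : torsion_free P.

(** An arrow only relates elements of the same positive dimension, so a [prec]-chain stays in one
    layer of P and acyclicity applies to it. *)
Lemma prec_irr x : ~ prec x x.
Proof.
move=> xx.
have h1 : 1 <= hdim x.
  have H a b : prec a b -> 1 <= hdim a by elim=> [c d /arrow_hdim[]|].
  exact: H xx.
apply: (tf_acyclic tf h1).
have H y z : prec y z -> hdim y = hdim x ->
    tri [pred v | hdim v == hdim x] y z.
  elim=> {y z} [y z yz hy|a b c ab IHab bc IHbc ha].
    apply: t_step; split => //; rewrite inE; first exact/eqP.
    by have [<- _] := arrow_hdim yz; apply/eqP.
  apply: t_trans (IHab ha) (IHbc _).
  by rewrite -(prec_hdim ab).
exact: H xx erefl.
Qed.

Lemma hbd_disj u : hbd Pos u `&` hbd Neg u = fset0.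
Proof.
by apply/eqP/negPn/negP => uu; apply: (@prec_irr u); apply: t_step.
Qed.

(** Descent on the set of predecessors in [G]: passing from [g0] to a predecessor [h] loses at least
    [h] itself, by irreflexivity. *)
Lemma exists_minimal_rel (r : rel P) G :
  (forall x, ~ clos_trans P r x x) -> G != fset0 ->
  exists2 g, g \in G & forall h, h \in G -> ~~ r h g.
Proof.
move=> irr /fset0Pn[g0 g0G].
pose D g := [fset h in G | `[< clos_trans P r h g >]].
have [k] := ubnP #|` D g0|.
elim: k => // k IH in g0 g0G *; rewrite ltnS => Dk.
case: (pselect (exists2 h, h \in G & r h g0)) => [[h hG hg]|no].
  apply: (IH h hG); apply: leq_trans Dk; apply: fproper_ltn_card.
  rewrite fproperE; apply/andP; split.
    apply/fsubsetP => a; rewrite !inE /= => /andP[-> /asboolP ah] /=.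
    by apply/asboolP; apply: t_trans ah _; apply: t_step.
  apply/negP => /fsubsetP /(_ h); rewrite !inE /= hG /=.
  have /asboolP -> : clos_trans P r h g0 by apply: t_step.
  by move=> /(_ isT) /asboolP /irr.
exists g0 => // h hG; apply/negP => hg; apply: no; by exists h.
Qed.

Lemma exists_minimal G : G != fset0 ->
  exists2 g, g \in G & forall h, h \in G -> ~~ arrow h g.
Proof. exact: exists_minimal_rel prec_irr. Qed.

Lemma exists_maximal G : G != fset0 ->
  exists2 g, g \in G & forall h, h \in G -> ~~ arrow g h.
Proof.
apply: (@exists_minimal_rel (fun x y => arrow y x)) => x xx.
have H a b : clos_trans P (fun x y => arrow y x) a b -> prec b a.
  elim=> {a b} [a b ab|a b c _ IHab _ IHbc]; first exact: t_step.
  exact: t_trans IHbc IHab.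
exact: prec_irr (H _ _ xx).
Qed.

Lemma atom_top u e : atom u (hdim u) e = [fset u].
Proof. by rewrite /atom leqnn subnn. Qed.

Lemma atom_gt u e j : hdim u < j -> atom u j e = fset0.
Proof. by move=> uj; rewrite /atom leqNgt uj. Qed.

Lemma atom_step u n e : n < hdim u -> atom u n e = hbd_strict e (atom u n.+1 e).
Proof.
by move=> nu; rewrite /atom nu (ltnW nu) -(subnSK nu).
Qed.

Lemma atom_hdim u n e x : x \in atom u n e -> hdim x = n.
Proof.
have [nu|nu] := leqP n (hdim u); last by rewrite atom_gt.
by have [[h _ _] _ _] := tf_relevance tf u; apply: h.
Qed.

Lemma atom_fork_free u n e : n <= hdim u -> fork_free n (atom u n e).
Proof. by have [_ _ h] := tf_relevance tf u; apply: h. Qed.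

(** The definition of atoms gives the case [e = e']; the mixed cases come from the move equations of
    the cell [atom u]. This is why the source and the target of an atom can be substituted for each
    other one dimension up. *)
Lemma atom_strict u n e e' : n < hdim u ->
  hbd_strict e (atom u n.+1 e') = atom u n e.
Proof.
move=> nu; have [_ mv _] := tf_relevance tf u.
have [m1 m2] := mv n Neg nu; have [m3 m4] := mv n Pos nu.
have sN := @atom_step u n Neg nu; have sP := @atom_step u n Pos nu.
case: e e' => [] []; rewrite /= in sN sP *.
- exact: esym.
- by rewrite [RHS]m3 sP; fset_solve.
- by rewrite [RHS]m2 sN; fset_solve.
- exact: esym.
Qed.

Lemma atom_disj u n : n < hdim u -> atom u n Neg `&` atom u n Pos = fset0.
Proof.
move=> nu; rewrite -!(@atom_strict u n _ Neg nu) /=; fset_solve.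
Qed.

Lemma atom_hbd g n e : hdim g = n.+1 -> atom g n e = hbd e g.
Proof.
move=> gn; have := @atom_step g n e; rewrite gn ltnSn => -> //.
rewrite -gn atom_top hbd_strictE !hbdU1; have := hbd_disj g.
by case: e => /= h; fset_solve.
Qed.

End Combinatorics.

(** * Gluing sets and replacing atoms in the top of a cell *)

Section Gluing.
Variable P : hypergraph.
Implicit Types (S T U V W G : {fset P}) (u v w x y g h : P) (e : sign) (X Y A B : layers P).
Hypothesis tf : torsion_free P.

Lemma act0 T : act fset0 T = T.
Proof. by rewrite /act !hbdU0 fsetU0 fsetD0. Qed.

(* The second hypothesis says that G1 is initial in G1 `|` G2: no element of G2
   immediately precedes an element of G1. *)
Lemma gluable_split n T G1 G2 : G1 `&` G2 = fset0 ->
  hbdU Neg G1 `&` hbdU Pos G2 = fset0 -> gluable n T (G1 `|` G2) ->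
  [/\ gluable n T G1, gluable n (act G1 T) G2
    & act G2 (act G1 T) = act (G1 `|` G2) T].
Proof.
move=> d12 i12 [Gd Gf Gs].
have dN := fork_free_disj Neg Gf (fsubsetUl G1 G2) (fsubsetUr G1 G2) d12.
have dP := fork_free_disj Pos Gf (fsubsetUl G1 G2) (fsubsetUr G1 G2) d12.
rewrite /= !hbdUU in Gs; rewrite /act /= !hbdUU.
split; [split|split|].
- by move=> u u1; apply: Gd; apply/fsetUP; left.
- exact: fork_free_sub (fsubsetUl _ _) Gf.
- by rewrite /=; fset_solve.
- by move=> u u1; apply: Gd; apply/fsetUP; right.
- exact: fork_free_sub (fsubsetUr _ _) Gf.
- by rewrite /=; fset_solve.
- by fset_solve.
Qed.

(* For hdim u = n+1 this is the gluing of a single generator (e = Neg), or its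
   inverse; the general case is what makes the induction on n go through. *)
Definition swappable n := forall A T u e, n < hdim u ->
  is_cell n (with_top n A T) -> atom u n e `<=` T ->
  atom u n (opp_sign e) `&` T = fset0 /\
  is_cell n (with_top n A ((T `\` atom u n e) `|` atom u n (opp_sign e))).

Section Swappable.
Variables (n : nat) (A : layers P).
Hypothesis sw : swappable n.

Lemma act1_cell T g : is_cell n (with_top n A T) -> hdim g = n.+1 ->
  hbd Neg g `<=` T ->
  hbd Pos g `&` T = fset0 /\ is_cell n (with_top n A (act [fset g] T)).
Proof.
move=> cT gn gT; have ng : n < hdim g by rewrite gn.
have := sw (e := Neg) ng cT; rewrite !atom_hbd // => /(_ gT)[dg cg].
split=> //; rewrite /act !hbdU1.
have hg := hbd_disj tf g.
suff -> : (T `|` hbd Pos g) `\` hbd Neg g = T `\` hbd Neg g `|` hbd Pos g by [].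
by fset_solve.
Qed.

(** Induction on the size of [G]: a minimal element is glued by [act1_cell], and by minimality the
    rest is gluable afterwards. The last equation says that gluing is reversible, which is the half
    of [moves] that [act] does not give by definition. *)
Lemma glue T G : is_cell n (with_top n A T) -> gluable n T G ->
  [/\ T `&` hbdU Pos G = fset0, is_cell n (with_top n A (act G T))
    & T = (act G T `|` hbdU Neg G) `\` hbdU Pos G].
Proof.
have [k] := ubnP #|` G|; elim: k => // k IH in T G *; rewrite ltnS => Gk cT gG.
have [G0|/(exists_minimal tf)[g gG' gmin]] := eqVneq G fset0.
  by rewrite G0 act0 !hbdU0 fsetI0 fsetD0 fsetU0.
have d12 : [fset g] `&` (G `\ g) = fset0.
  by apply/fsetP => z; rewrite !inE; case: eqP.
have i12 : hbdU Neg [fset g] `&` hbdU Pos (G `\ g) = fset0.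
  apply/fsetP => z; rewrite hbdU1 in_fsetI in_fset0; apply/negP => /andP[zg].
  move=> /hbdUP[h /fsetD1P[_ hG] zh]; have /negP[] := gmin h hG.
  by apply/arrowP; exists z.
have Ge := fsetD1K gG'.
have gG1 := gG; rewrite -Ge in gG1.
have [g1 g2 ge] := gluable_split d12 i12 gG1.
have [gd gs] : hdim g = n.+1 /\ hbd Neg g `<=` T.
  have [h1 _ h2] := g1; split; first by apply: h1; rewrite inE.
  by rewrite /= !hbdU1 in h2; have hg := hbd_disj tf g; fset_solve.
have [dg cg] := act1_cell cT gd gs.
have Gk' : #|` G `\ g| < k.
  by apply: leq_trans Gk; rewrite (cardfsD1 g G) gG'.
have [e1 e2 e3] := IH _ _ Gk' cg g2.
have e4 : T `&` hbdU Pos G = fset0.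
  rewrite -Ge hbdUU hbdU1; rewrite /act !hbdU1 in e1.
  rewrite hbdU1 in i12; clear - dg e1 i12; fset_solve.
split=> //; first by rewrite -Ge -ge.
have [_ _ /= gs'] := gG; rewrite /act; clear - e4 gs'; fset_solve.
Qed.

(* If z were consumed by g in G1 and produced by h in G2, the part of G1 above
   g and the part of G2 below h would commute, so h could be applied before g
   is, when z is still present. *)
Lemma glue_acyclic T G1 G2 : is_cell n (with_top n A T) ->
  gluable n T G1 -> gluable n (act G1 T) G2 ->
  hbdU Neg G1 `&` hbdU Pos G2 = fset0.
Proof.
move=> cT g1 g2; apply/fsetP => z; rewrite in_fsetI in_fset0; apply/negP.
move=> /andP[/hbdUP[g gG zg] /hbdUP[h hG zh]].
have hg : prec h g by apply: t_step; apply/arrowP; exists z.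
pose up w := w = g \/ prec g w.
pose dn w := w = h \/ prec w h.
pose U := [fset w in G1 | `[< up w >]]; pose U' := [fset w in G1 | ~~ `[< up w >]].
pose D := [fset w in G2 | `[< dn w >]]; pose D' := [fset w in G2 | ~~ `[< dn w >]].
have UE : U' `|` U = G1.
  by apply/fsetP => w; rewrite !inE /=; case: (w \in G1); case: asboolP.
have DE : D `|` D' = G2.
  by apply/fsetP => w; rewrite !inE /=; case: (w \in G2); case: asboolP.
have dU : U' `&` U = fset0.
  by apply/fsetP => w; rewrite !inE /=; case: (w \in G1); case: asboolP.
have dD : D `&` D' = fset0.
  by apply/fsetP => w; rewrite !inE /=; case: (w \in G2); case: asboolP.
have iU : hbdU Neg U' `&` hbdU Pos U = fset0.
  apply/fsetP => w; rewrite in_fsetI in_fset0; apply/negP.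
  move=> /andP[/hbdUP[b + wb] /hbdUP[a + wa]].
  rewrite !inE /= => /andP[_ /asboolP nb] /andP[_ /asboolP ua]; apply: nb; right.
  have ab : prec a b by apply: t_step; apply/arrowP; exists w.
  by case: ua => [<-|ga] //; apply: t_trans ga ab.
have iD : hbdU Neg D `&` hbdU Pos D' = fset0.
  apply/fsetP => w; rewrite in_fsetI in_fset0; apply/negP.
  move=> /andP[/hbdUP[b + wb] /hbdUP[a + wa]].
  rewrite !inE /= => /andP[_ /asboolP ub] /andP[_ /asboolP na]; apply: na; right.
  have ab : prec a b by apply: t_step; apply/arrowP; exists w.
  by case: ub => [<-|ga] //; apply: t_trans ab ga.
have iUD : hbdU Pos U `&` hbdU Neg D = fset0.
  apply/fsetP => w; rewrite in_fsetI in_fset0; apply/negP.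
  move=> /andP[/hbdUP[a + wa] /hbdUP[b + wb]].
  rewrite !inE /= => /andP[_ /asboolP ua] /andP[_ /asboolP db].
  have ab : prec a b by apply: t_step; apply/arrowP; exists w.
  have gb : prec g b by case: ua => [<-|ga] //; apply: t_trans ga ab.
  have gh : prec g h by case: db => [<-|bh] //; apply: t_trans gb bh.
  by apply: (@prec_irr P tf g); apply: t_trans gh hg.
have Uz : z \notin hbdU Pos U.
  apply/negP => /hbdUP[c + zc]; rewrite !inE /= => /andP[_ /asboolP uc].
  have cg : prec c g by apply: t_step; apply/arrowP; exists z.
  case: uc => [cE|gc]; first by apply: (@prec_irr P tf g); rewrite -{1}cE.
  by apply: (@prec_irr P tf g); apply: t_trans gc cg.
have zU : z \in hbdU Neg U.
  apply/hbdUP; exists g => //; rewrite !inE /= gG; apply/asboolP; by left.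
have zD : z \in hbdU Pos D.
  apply/hbdUP; exists h => //; rewrite !inE /= hG; apply/asboolP; by left.
rewrite -UE in g1 g2; rewrite -DE in g2.
have [gU' gU eU] := gluable_split dU iU g1.
rewrite -eU in g2.
have [_ cU' _] := glue cT gU'.
have [gD _ _] := gluable_split dD iD g2.
have [_ _ sU] := gU.
have gD' : gluable n (act U' T) D.
  have [h1 h2 h3] := gD; split=> //; move: h3; rewrite /= {1}/act.
  by move: (act U' T) => T0; clear - iUD; move=> h3; fset_solve.
have [/fsetP/(_ z) zT _ _] := glue cU' gD'.
move: zT (fsubsetP sU z) Uz zU zD; rewrite /= in_fsetI in_fsetD.
by move: (act U' T) => T0; fset_bool.
Qed.

(** Two successive gluings amount to a single one. Once [glue_acyclic] and the disjointness
    statements of [glue] are known, only Boolean algebra remains, apart from the disjointness of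
    [G1] and [G2]. *)
Lemma glue_cat T G1 G2 : is_cell n (with_top n A T) ->
  gluable n T G1 -> gluable n (act G1 T) G2 ->
  [/\ G1 `&` G2 = fset0, hbdU Neg G1 `&` hbdU Pos G2 = fset0,
      gluable n T (G1 `|` G2) & act (G1 `|` G2) T = act G2 (act G1 T)].
Proof.
move=> cT g1 g2; have i12 := glue_acyclic cT g1 g2.
have [_ cT1 _] := glue cT g1; have [p2 _ _] := glue cT1 g2.
have [d1 f1 s1] := g1; have [d2 f2 s2] := g2.
rewrite /= /act in s1 s2 p2.
have dN : hbdU Neg G1 `&` hbdU Neg G2 = fset0.
  by clear - i12 s2; fset_solve.
have dP : hbdU Pos G1 `&` hbdU Pos G2 = fset0.
  by clear - i12 p2; fset_solve.
split=> //.
(* Non-emptiness enters here: a common element would have a source face, lying in two disjoint sets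
   of faces. *)
- apply/fsetP => g; rewrite in_fsetI in_fset0; apply/negP => /andP[gG1 gG2].
  have /fset0Pn[z zg] : hbd Neg g != fset0.
    by apply: (tf_nonempty tf); rewrite (d1 _ gG1).
  move/fsetP/(_ z): dN; rewrite in_fsetI in_fset0 => /negP[]; apply/andP.
  by split; apply/hbdUP; exists g.
- split=> [u /fsetUP[]||]; [exact: d1|exact: d2| |].
    by apply: fork_freeU => // -[].
  by rewrite /= !hbdUU; clear - s1 s2 i12; fset_solve.
- by rewrite /act !hbdUU; clear - i12; fset_solve.
Qed.

End Swappable.

Lemma cell_with_top n A T : is_cell n (with_top n A T) <->
  [/\ forall u, u \in T -> hdim u = n, fork_free n T,
      forall i e u, i < n -> u \in A i e -> hdim u = i,
      forall i e, i < n -> fork_free i (A i e)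
    & forall i e, i < n -> moves (if i.+1 == n then T else A i.+1 e) (A i Neg) (A i Pos)].
Proof.
split.
  move=> [[Xd _ _] Xm Xf]; split.
  - by move=> u uT; apply: (Xd n Neg); rewrite with_topE.
  - by rewrite -(with_topE n A T Neg); apply: Xf.
  - by move=> i e u li ui; apply: (Xd i e); rewrite with_top_lt.
  - by move=> i e li; rewrite -(with_top_lt A T e li); apply/Xf/ltnW.
  - move=> i e li; have := Xm i e li; rewrite !(with_top_lt _ _ _ li).
    case: eqP => [->|/eqP ni]; first by rewrite with_topE.
    by rewrite with_top_lt // ltn_neqAle ni.
move=> [Td Tf Ad Af Am]; split; first split.
- move=> i e u; case: (ltngtP i n) => [li|li|->].
  + by rewrite with_top_lt //; apply: Ad.
  + by rewrite with_top_gt.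
  + by rewrite with_topE; apply: Td.
- by rewrite !with_topE.
- by move=> i e; apply: with_top_gt.
- move=> i e li; have := Am i e li; rewrite !(with_top_lt _ _ _ li).
  case: eqP => [->|/eqP ni]; first by rewrite with_topE.
  by rewrite with_top_lt // ltn_neqAle ni.
- move=> i e; rewrite leq_eqVlt => /predU1P[->|li]; first by rewrite with_topE.
  by rewrite with_top_lt //; apply: Af.
Qed.

Lemma cell_boundary n A T e : is_cell n.+1 (with_top n.+1 A T) ->
  [/\ is_cell n (with_top n A (A n e)), gluable n (A n Neg) T
    & A n Pos = act T (A n Neg)].
Proof.
move=> /cell_with_top[Td Tf Ad Af Am].
have [m1 m2] := Am n e (ltnSn n); rewrite eqxx in m1 m2.
split; last exact: m2.
  apply/cell_with_top; split.
  - by move=> u; apply: Ad.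
  - exact: Af.
  - by move=> i e' u li; apply: Ad; apply: ltnW.
  - by move=> i e' li; apply: Af; apply: ltnW.
  - move=> i e' li; case: eqP => [E|ni].
      by have := Am i e (ltnW li); rewrite E (ltn_eqF (ltnSn n)).
    by have := Am i e' (ltnW li); rewrite eqSS (ltn_eqF li).
by split=> //; rewrite /= {}m1; clear m2; fset_solve.
Qed.

(** Together with its converse [cell_boundary], this reduces (n+1)-cells to n-cells with a gluable
    set: that the target is a cell and that the move is reversible both come from [glue]. *)
Lemma glue_cell n A G : swappable n -> is_cell n (with_top n A (A n Neg)) ->
  gluable n (A n Neg) G -> A n Pos = act G (A n Neg) ->
  is_cell n.+1 (with_top n.+1 A G).
Proof.
move=> sw cA gG eA; have [_ cA' eA'] := glue sw cA gG.
rewrite -eA in cA' eA'.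
have [Td Tf Ad Af Am] := (cell_with_top _ _ _).1 cA.
have [Td' Tf' _ _ Am'] := (cell_with_top _ _ _).1 cA'.
have [Gd Gf _] := gG.
apply/cell_with_top; split=> //.
- move=> i e u; rewrite ltnS leq_eqVlt => /predU1P[->|li]; last exact: Ad.
  by case: e; [apply: Td|apply: Td'].
- move=> i e; rewrite ltnS leq_eqVlt => /predU1P[->|li]; last exact: Af.
  by case: e.
- move=> i e; rewrite ltnS leq_eqVlt => /predU1P[->|li].
    by rewrite eqxx; split.
  rewrite eqSS (ltn_eqF li).
  have := Am i e li; have := Am' i e li.
  by case: eqP => // -> ; case: e.
Qed.

(** In this form the action visibly depends on the strict boundaries alone, so that by [atom_strict]
    the two atoms of [u] in a given dimension act alike. *)
Lemma act_disj T G : T `&` hbdU Pos G = fset0 ->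
  act G T = (T `\` hbd_strict Neg G) `|` hbd_strict Pos G.
Proof. by rewrite /act /= => d; fset_solve. Qed.

Definition lower_part T S : {fset P} :=
  [fset x in T | (x \notin S) && `[< exists2 s, s \in S & tri (mem T) x s >]].

(** Among the elements outside [S], those below [S] go first and all others last. The segment
    condition is what excludes an arrow from [S] back into [U]; an arrow from [V] into [U] or [S]
    would put its origin below [S], hence in [U]. *)
Lemma segment_split T S : S `<=` T -> segment (mem T) S ->
  let U := lower_part T S in let V := T `\` (U `|` S) in
  [/\ U `&` (S `|` V) = fset0, S `&` V = fset0, U `|` (S `|` V) = T,
      hbdU Neg U `&` hbdU Pos (S `|` V) = fset0
    & hbdU Neg S `&` hbdU Pos V = fset0].
Proof.
move=> sST seg U V.
have US : U `&` S = fset0.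
  by apply/fsetP => x; rewrite !inE /=; case: (x \in S); rewrite ?andbF.
have UT : U `<=` T.
  by apply/fsubsetP => x; rewrite !inE /= => /and3P[].
split.
- by rewrite /V; fset_solve.
- by rewrite /V; fset_solve.
- by rewrite /V; fset_solve.
- apply/fsetP => z; rewrite in_fsetI in_fset0; apply/negP.
  move=> /andP[/hbdUP[b bU zb] /hbdUP[a aV za]].
  have aT : a \in T.
    by apply: fsubsetP aV; rewrite /V; fset_solve.
  have bT : b \in T by apply: fsubsetP bU.
  have ab : tri (mem T) a b.
    apply: t_step; split => //; apply/fset0Pn; exists z; exact/fsetIP.
  move: bU; rewrite !inE /= => /and3P[_ bS /asboolP[s sS bs]].
  have [aS|aS] := boolP (a \in S).
    by have := seg _ _ _ aS sS ab bs; rewrite (negPf bS).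
  have : a \in U.
    rewrite !inE /= aT aS; apply/asboolP; exists s => //.
    exact: t_trans ab bs.
  by move: aV; rewrite /V in_fsetU in_fsetD in_fsetU (negPf aS) /= orbF => /andP[/negPf->].
- apply/fsetP => z; rewrite in_fsetI in_fset0; apply/negP.
  move=> /andP[/hbdUP[b bS zb] /hbdUP[a aV za]].
  have [aT aS] : a \in T /\ a \notin S.
    by move: aV; rewrite /V in_fsetD in_fsetU negb_or => /andP[/andP[]].
  have bT : b \in T by apply: fsubsetP bS.
  have ab : tri (mem T) a b.
    apply: t_step; split => //; apply/fset0Pn; exists z; exact/fsetIP.
  have : a \in U by rewrite !inE /= aT aS; apply/asboolP; exists b.
  by move: aV; rewrite /V in_fsetD in_fsetU negb_or => /andP[/andP[/negPf->]].
Qed.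

(** Fork-freeness in dimension 0 makes [T] and the atom singletons, so the inclusion is an equality
    and [T] is replaced as a whole. *)
Lemma swappable0 : swappable 0.
Proof.
move=> A T u e u0 /cell_with_top[Td Tf _ _ _] sT.
have E : atom u 0 e = T.
  apply/eqP; rewrite eqEfcard sT /=; rewrite /= in Tf; rewrite Tf.
  by have /= -> := atom_fork_free tf e (leq0n (hdim u)).
have d := atom_disj tf u0.
split; first by rewrite -E; case: e {sT E} => /=; rewrite // fsetIC.
rewrite -E fsetDv fset0U; apply/cell_with_top; split=> //.
  by move=> v; apply: atom_hdim.
exact: atom_fork_free.
Qed.

(* Both <u>_{n+1,-} and <u>_{n+1,+} move <u>_{n,-} to <u>_{n,+}; as the given one
   is a segment, it can be replaced by the other. *)
Lemma swappableS n : swappable n -> swappable n.+1.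
Proof.
move=> sw A T u e nu cT sST.
have [cA gT eT] := cell_boundary Neg cT.
set S := atom u n.+1 e in sST *; set S' := atom u n.+1 (opp_sign e).
have nu' : n < hdim u := ltnW nu.
have seg : segment (mem T) S.
  have E : top (mk_cell cT) = T.
    by rewrite /top /= with_topE.
  by rewrite -E; apply: (tf_segment tf) => //; rewrite E.
have [dU dS UE iU iS] := segment_split sST seg.
set U := lower_part T S in dU dS UE iU iS *.
set V := T `\` (U `|` S) in dU dS UE iU iS *.
have SS' : S `&` S' = fset0.
  have := atom_disj tf nu; rewrite /S /S'; case: e {S S' sST seg dU dS UE iU iS U V} => //=.
  by rewrite fsetIC.
rewrite -UE in gT.
have [gU gSV eSV] := gluable_split dU iU gT.
have [gS gV eV] := gluable_split dS iS gSV.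
have [_ cU _] := glue sw cA gU.
have gS' : gluable n (act U (A n Neg)) S'.
  split; first by move=> v; apply: atom_hdim.
    exact: atom_fork_free.
  by have [_ _] := gS; rewrite /S /S' !atom_strict.
have eS : act S' (act U (A n Neg)) = act S (act U (A n Neg)).
  have [p _ _] := glue sw cU gS; have [p' _ _] := glue sw cU gS'.
  by rewrite (act_disj p) (act_disj p') /S /S' !atom_strict.
rewrite -eS in gV eV.
have [d1 i1 g1 e1] := glue_cat sw cA gU gS'.
rewrite -e1 in gV.
have [d2 i2 g2 e2] := glue_cat sw cA g1 gV.
have E : T `\` S `|` S' = U `|` S' `|` V.
  by clear - UE dU dS SS'; fset_solve.
split; first by clear - UE dU dS SS' d1 d2; fset_solve.
rewrite E; apply: glue_cell => //.
by rewrite e2 e1 eV eSV eT UE.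
Qed.

Lemma swappable_all n : swappable n.
Proof. by elim: n => [|n IH]; [apply: swappable0|apply: swappableS]. Qed.

End Gluing.

(** * Composition of cells *)

Section Layers.
Variable P : hypergraph.
Implicit Types (S T U V W G : {fset P}) (u v w x y g h : P) (e : sign) (X Y Z A B : layers P).

Lemma layersP X Y : (forall j e, X j e = Y j e) -> X = Y.
Proof.
move=> XY; apply: functional_extensionality_dep => j.
by apply: functional_extensionality_dep => e.
Qed.

Lemma layers_bdE e i X : layers_bd e i X = with_top i X (X i e).
Proof.
by apply: layersP => j e'; rewrite /layers_bd /with_top; case: ltngtP => // ->.
Qed.

Lemma layers_comp_lt i X Y j e : j < i -> layers_comp i X Y j e = X j e.
Proof. by rewrite /layers_comp => ->. Qed.

Lemma layers_comp_neg i X Y : layers_comp i X Y i Neg = X i Neg.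
Proof. by rewrite /layers_comp ltnn eqxx. Qed.

Lemma layers_comp_pos i X Y : layers_comp i X Y i Pos = Y i Pos.
Proof. by rewrite /layers_comp ltnn eqxx. Qed.

Lemma layers_comp_gt i X Y j e : i < j -> layers_comp i X Y j e = X j e `|` Y j e.
Proof. by move=> ij; rewrite /layers_comp ltnNge (ltnW ij) gtn_eqF. Qed.

Lemma layers_bd_lt e i X j e' : j < i -> layers_bd e i X j e' = X j e'.
Proof. by rewrite /layers_bd => ->. Qed.

Lemma layers_bd_eq e i X e' : layers_bd e i X i e' = X i e.
Proof. by rewrite /layers_bd ltnn eqxx. Qed.

Lemma layers_bd_gt e i X j e' : i < j -> layers_bd e i X j e' = fset0.
Proof. by move=> ij; rewrite /layers_bd ltnNge (ltnW ij) gtn_eqF. Qed.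

Lemma layers_bd_bd e e' i j X : i < j ->
  layers_bd e i (layers_bd e' j X) = layers_bd e i X.
Proof.
move=> ij; apply: layersP => l e''; case: (ltngtP l i) => [li|li|->].
- by rewrite !layers_bd_lt // (ltn_trans li ij).
- by rewrite !layers_bd_gt.
- by rewrite !layers_bd_eq layers_bd_lt.
Qed.

Lemma bd_comp_neg i X Y : layers_bd Neg i (layers_comp i X Y) = layers_bd Neg i X.
Proof.
apply: layersP => l e; case: (ltngtP l i) => [li|li|->].
- by rewrite !layers_bd_lt // layers_comp_lt.
- by rewrite !layers_bd_gt.
- by rewrite !layers_bd_eq layers_comp_neg.
Qed.

Definition layers_cmp i X Y := layers_bd Pos i X = layers_bd Neg i Y.

Lemma cmp_lt i X Y j e : layers_cmp i X Y -> j < i -> X j e = Y j e.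
Proof.
move=> /(congr1 (fun F : layers P => F j e)) + ji.
by rewrite !layers_bd_lt.
Qed.

Lemma cmp_eq i X Y : layers_cmp i X Y -> X i Pos = Y i Neg.
Proof. by move=> /(congr1 (fun F : layers P => F i Neg)); rewrite !layers_bd_eq. Qed.

Lemma cmp_bd i l e X Y : layers_cmp l X Y -> i < l ->
  layers_bd e i X = layers_bd e i Y.
Proof.
move=> c il; apply: layersP => j e'; case: (ltngtP j i) => [li|li|->].
- by rewrite !layers_bd_lt // (cmp_lt _ c) // (ltn_trans li).
- by rewrite !layers_bd_gt.
- by rewrite !layers_bd_eq (cmp_lt _ c).
Qed.

Lemma cmpP i X Y : (forall j e, j < i -> X j e = Y j e) -> X i Pos = Y i Neg ->
  layers_cmp i X Y.
Proof.
move=> Xj Xi; apply: layersP => l e; case: (ltngtP l i) => [li|li|->].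
- by rewrite !layers_bd_lt // Xj.
- by rewrite !layers_bd_gt.
- by rewrite !layers_bd_eq.
Qed.

Lemma bd_comp_pos i X Y : layers_cmp i X Y ->
  layers_bd Pos i (layers_comp i X Y) = layers_bd Pos i Y.
Proof.
move=> XY; apply: layersP => l e; case: (ltngtP l i) => [li|li|->].
- by rewrite !layers_bd_lt // layers_comp_lt // (cmp_lt _ XY).
- by rewrite !layers_bd_gt.
- by rewrite !layers_bd_eq layers_comp_pos.
Qed.

Lemma bd_comp_gt e i j X Y : i < j -> layers_bd e j (layers_comp i X Y) =
  layers_comp i (layers_bd e j X) (layers_bd e j Y).
Proof.
move=> ij; apply: layersP => l e'; case: (ltngtP l i) => [li|li|->].
- by rewrite layers_comp_lt // !layers_bd_lt ?layers_comp_lt // (ltn_trans li ij).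
- rewrite layers_comp_gt //; case: (ltngtP l j) => [lj|lj|->].
  + by rewrite !layers_bd_lt // layers_comp_gt.
  + by rewrite !layers_bd_gt // fsetU0.
  + by rewrite !layers_bd_eq layers_comp_gt.
- rewrite layers_bd_lt //; case: e'.
  + by rewrite !layers_comp_neg layers_bd_lt.
  + by rewrite !layers_comp_pos layers_bd_lt.
Qed.

Lemma bd_comp_lt e i j X Y : i < j -> layers_cmp j X Y ->
  layers_bd e i (layers_comp j X Y) = layers_bd e i X.
Proof.
move=> ij XY; apply: layersP => l e'; case: (ltngtP l i) => [li|li|->].
- by rewrite !layers_bd_lt // layers_comp_lt // (ltn_trans li ij).
- by rewrite !layers_bd_gt.
- by rewrite !layers_bd_eq layers_comp_lt.
Qed.

Lemma layers_compA i X Y Z :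
  layers_comp i (layers_comp i X Y) Z = layers_comp i X (layers_comp i Y Z).
Proof.
apply: layersP => l e; case: (ltngtP l i) => [li|li|->].
- by rewrite !layers_comp_lt.
- by rewrite !layers_comp_gt // fsetUA.
- by case: e; rewrite ?layers_comp_neg ?layers_comp_pos.
Qed.

Lemma layers_exchange i j X X' Y Y' : i < j ->
  layers_comp i (layers_comp j X X') (layers_comp j Y Y') =
  layers_comp j (layers_comp i X Y) (layers_comp i X' Y').
Proof.
move=> ij; apply: layersP => l e; case: (ltngtP l i) => [li|li|->].
- by rewrite ?(layers_comp_lt, ltn_trans li ij).
- rewrite layers_comp_gt //; case: (ltngtP l j) => [lj|lj|->].
  + by rewrite !(layers_comp_lt _ _ _ lj) layers_comp_gt.
  + by rewrite !layers_comp_gt // fsetUACA.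
  + by case: e; rewrite ?layers_comp_neg ?layers_comp_pos layers_comp_gt.
- rewrite (layers_comp_lt _ _ _ ij).
  by case: e; rewrite ?layers_comp_neg ?layers_comp_pos (layers_comp_lt _ _ _ ij).
Qed.

(* In the encoding of cells by layers, these are the iterated identities of i-cells. *)
Definition degenerate i X := forall j e, i < j -> X j e = fset0.

Lemma degenerate_bd e i X : degenerate i (layers_bd e i X).
Proof. by move=> j e' ij; rewrite layers_bd_gt. Qed.

Lemma degenerateW i j X : i <= j -> degenerate i X -> degenerate j X.
Proof. by move=> ij dX l e jl; apply: dX; apply: leq_ltn_trans jl. Qed.

Lemma degenerate_comp i j X Y : i <= j -> degenerate j X -> degenerate j Y ->
  degenerate j (layers_comp i X Y).
Proof.
move=> ij dX dY l e jl.
by rewrite layers_comp_gt ?dX ?dY ?fsetU0 // (leq_ltn_trans ij).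
Qed.

Lemma comp_idl i X Y : degenerate i X -> layers_cmp i X Y -> X i Neg = X i Pos ->
  layers_comp i X Y = Y.
Proof.
move=> dX XY Xi; apply: layersP => l e; case: (ltngtP l i) => [li|li|->].
- by rewrite layers_comp_lt // (cmp_lt _ XY).
- by rewrite layers_comp_gt // dX // fset0U.
- by case: e; rewrite ?layers_comp_neg ?layers_comp_pos // Xi (cmp_eq XY).
Qed.

Lemma comp_idr i X Y : degenerate i Y -> layers_cmp i X Y -> Y i Neg = Y i Pos ->
  layers_comp i X Y = X.
Proof.
move=> dY XY Yi; apply: layersP => l e; case: (ltngtP l i) => [li|li|->].
- by rewrite layers_comp_lt // (cmp_lt _ XY).
- by rewrite layers_comp_gt // dY // fsetU0.
- by case: e; rewrite ?layers_comp_neg ?layers_comp_pos // -Yi (cmp_eq XY).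
Qed.

Lemma cell_leq j k X : j <= k -> is_cell j X -> is_cell k X.
Proof.
by move=> /subnK <-; elim: (k - j) => //= d IH /IH; apply: is_cell_id.
Qed.

Lemma cell_layer k X j e : is_cell k X -> j <= k ->
  is_cell j (with_top j X (X j e)).
Proof.
move=> cX; rewrite leq_eqVlt => /predU1P[->|jk]; first by rewrite with_top_id.
by rewrite -layers_bdE; apply: is_cell_bd cX.
Qed.

Lemma cell_moves k X i e : is_cell k X -> i < k -> moves (X i.+1 e) (X i Neg) (X i Pos).
Proof. by move=> [_ mX _]; apply: mX. Qed.

Lemma cell_degenerate k X : is_cell k X -> degenerate k X.
Proof. by move=> [[_ _ dX] _ _]. Qed.

Lemma degenerate_sign k X i : is_cell k X -> degenerate i X -> i <= k -> X i Neg = X i Pos.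
Proof.
move=> cX dX; rewrite leq_eqVlt => /predU1P[->|ik]; first by have [[_ ->]] := cX.
have [_ ->] := cell_moves Neg cX ik.
by rewrite (dX i.+1) // !hbdU0 fsetU0 fsetD0.
Qed.

(** The missing layer [X i (opp_sign e)] is computed from [X i e] and [X i.+1 Neg] by a move
    equation. This is the standard way below to recognize that two cells are equal. *)
Lemma cell_det e i k X Y : is_cell k X -> is_cell k Y -> i < k ->
  (forall j e', i < j -> X j e' = Y j e') -> layers_bd e i X = layers_bd e i Y ->
  X = Y.
Proof.
move=> cX cY ik XY bXY.
have lXY j e' : j < i -> X j e' = Y j e'.
  move=> ji; have := congr1 (fun F : layers P => F j e') bXY.
  by rewrite /= !layers_bd_lt.
have iXY : X i e = Y i e.
  by have := congr1 (fun F : layers P => F i e) bXY; rewrite /= !layers_bd_eq.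
have XY1 := XY i.+1 Neg (ltnSn i).
have [mX1 mX2] := cell_moves Neg cX ik; have [mY1 mY2] := cell_moves Neg cY ik.
have iXY' : X i (opp_sign e) = Y i (opp_sign e).
  by case: e iXY {bXY} => /= iXY; [rewrite mX2 mY2|rewrite mX1 mY1]; rewrite iXY XY1.
apply: layersP => l e'; case: (ltngtP l i) => [li|li|->]; [exact: lXY|exact: XY|].
by case: e e' iXY iXY' {bXY} => [] [].
Qed.

Lemma cell_hdim k X j e u : is_cell k X -> u \in X j e -> hdim u = j.
Proof. by move=> [[h _ _] _ _]; apply: h. Qed.

End Layers.

(** * Composites of cells, cuts of cells, and items *)

Section Composition.
Variable P : hypergraph.
Implicit Types (S T U V W G : {fset P}) (u v w x y g h : P) (e : sign) (X Y Z A B : layers P).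
Hypothesis tf : torsion_free P.

Lemma cell_glue k X i e : is_cell k X -> i < k ->
  [/\ gluable i (X i Neg) (X i.+1 e), X i Pos = act (X i.+1 e) (X i Neg)
    & X i Neg `&` hbdU Pos (X i.+1 e) = fset0].
Proof.
move=> cX ik; have [cb gb eb] := cell_boundary Neg (cell_layer e cX ik).
by have [d _ _] := glue tf (@swappable_all P tf i) cb gb.
Qed.

Lemma cell_of_top k X : degenerate k X -> X k Neg = X k Pos ->
  is_cell k (with_top k X (X k Neg)) -> is_cell k X.
Proof.
move=> dX sX; have -> // : with_top k X (X k Neg) = X.
apply: layersP => l e; case: (ltngtP l k) => [lk|lk|->].
- by rewrite with_top_lt.
- by rewrite with_top_gt // dX.
- by rewrite with_topE; case: e.
Qed.

(** The layers of the composite are built upwards from dimension [i], the top of [X] being glued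
    before that of [Y]. Disjointness of the layers is proved along the way, since the gluing in
    dimension j+1 relies on it in dimension j. *)
Theorem comp_cell i k X Y : i < k -> is_cell k X -> is_cell k Y -> layers_cmp i X Y ->
  [/\ is_cell k (layers_comp i X Y), forall j e, i < j -> X j e `&` Y j e = fset0
    & forall e, hbdU Neg (X i.+1 e) `&` hbdU Pos (Y i.+1 e) = fset0].
Proof.
move=> ik cX cY XY; set Z := layers_comp i X Y.
have sw := @swappable_all P tf.
have base : is_cell i (with_top i Z (Z i Neg)).
  rewrite /Z layers_comp_neg.
  have -> : with_top i (layers_comp i X Y) (X i Neg) = with_top i X (X i Neg).
    by apply: eq_with_top => j e ji; rewrite layers_comp_lt.
  exact: cell_layer cX (ltnW ik).
have H0 e : [/\ X i.+1 e `&` Y i.+1 e = fset0,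
    hbdU Neg (X i.+1 e) `&` hbdU Pos (Y i.+1 e) = fset0,
    gluable i (Z i Neg) (Z i.+1 e) & Z i Pos = act (Z i.+1 e) (Z i Neg)].
  rewrite /Z layers_comp_neg layers_comp_pos layers_comp_gt //.
  have [gX eX _] := cell_glue e cX ik; have [gY eY _] := cell_glue e cY ik.
  rewrite -(cmp_eq XY) eX in gY eY.
  rewrite /Z layers_comp_neg in base.
  have [d1 d2 d3 d4] := glue_cat tf (sw i) base gX gY.
  by split=> //; rewrite d4 eY.
have H j : i < j -> j <= k -> (forall e, is_cell j (with_top j Z (Z j e))) /\
    forall e, X j e `&` Y j e = fset0.
  elim: j => // j IH; rewrite ltnS leq_eqVlt => /predU1P[<- _|ij jk].
    split=> e; have [d1 d2 d3 d4] := H0 e => //.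
    exact: glue_cell.
  have [cZ dZ] := IH ij (ltnW jk).
  have G e : [/\ X j.+1 e `&` Y j.+1 e = fset0,
      gluable j (Z j Neg) (Z j.+1 e) & Z j Pos = act (Z j.+1 e) (Z j Neg)].
    have [gX eX _] := cell_glue e cX jk; have [gY eY _] := cell_glue e cY jk.
    have cZN := cZ Neg; have dN := dZ Neg; have dP := dZ Pos.
    have ij1 : i < j.+1 by apply: ltnW.
    rewrite /Z (layers_comp_gt _ _ _ ij) in cZN.
    rewrite /Z !(layers_comp_gt _ _ _ ij) (layers_comp_gt _ _ _ ij1).
    have [fX1 fX2 sX] := gX; have [fY1 fY2 sY] := gY.
    rewrite /= in sX sY.
    have gX' : gluable j (X j Neg `|` Y j Neg) (X j.+1 e).
      by split=> //=; clear - sX; fset_solve.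
    have [pX _ _] := glue tf (sw j) cZN gX'.
    (* The intermediate stage: [X] has already been moved to its target, while [Y] is still at its
       source. *)
    have eT : act (X j.+1 e) (X j Neg `|` Y j Neg) = X j Pos `|` Y j Neg.
      by rewrite eX /act; clear - pX dN sX; fset_solve.
    have d' : X j Pos `&` Y j Neg = fset0.
      by rewrite eX /act; clear - pX dN sX; fset_solve.
    have gY' : gluable j (act (X j.+1 e) (X j Neg `|` Y j Neg)) (Y j.+1 e).
      by rewrite eT; split=> //=; clear - sY; fset_solve.
    have [d1 d2 d3 d4] := glue_cat tf (sw j) cZN gX' gY'.
    have [_ cT _] := glue tf (sw j) cZN gX'.
    have [pY _ _] := glue tf (sw j) cT gY'.
    split=> //; rewrite d4 eT eY.
    rewrite eT in pY.
    rewrite /act; clear - pY d' sY; fset_solve.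
  split=> e; have [g1 g2 g3] := G e => //.
  exact: glue_cell.
split=> [|j e ij|e].
- apply: cell_of_top.
  + exact: degenerate_comp (ltnW ik) (cell_degenerate cX) (cell_degenerate cY).
  + by rewrite /Z !layers_comp_gt // (degenerate_sign cX (cell_degenerate cX)) //
      (degenerate_sign cY (cell_degenerate cY)).
  + by have [h _] := H k ik (leqnn k).
- have [jk|kj] := leqP j k; first by have [_ h] := H j ij jk.
  by rewrite (cell_degenerate cX) // fset0I.
- by have [] := H0 e.
Qed.

(** As the unions above dimension [i] are disjoint, the layers of the second factor are recovered by
    taking differences; its i-target is that of the composite. *)
Lemma comp_cancell i k X Y Y' : i < k -> is_cell k X -> is_cell k Y -> is_cell k Y' ->
  layers_cmp i X Y -> layers_cmp i X Y' -> layers_comp i X Y = layers_comp i X Y' ->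
  Y = Y'.
Proof.
move=> ik cX cY cY' XY XY' E.
have [_ d _] := comp_cell ik cX cY XY; have [_ d' _] := comp_cell ik cX cY' XY'.
apply: (cell_det (e := Pos) cY cY' ik) => [j e ij|].
  have Ej := congr1 (fun F : layers P => F j e) E.
  rewrite /= !layers_comp_gt // in Ej.
  have dj := d j e ij; have dj' := d' j e ij.
  by clear - Ej dj dj'; fset_solve.
by rewrite -(bd_comp_pos XY) E bd_comp_pos.
Qed.

(** Gluing the initial part [S1] alone yields the middle i-layer [M], which is the target of one
    factor and the source of the other. Both factors are built as (i+1)-cells and then regarded as
    k-cells. *)
Lemma cell_split i k X S1 S2 : i < k -> is_cell k X -> degenerate i.+1 X ->
  S1 `&` S2 = fset0 -> S1 `|` S2 = X i.+1 Neg ->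
  hbdU Neg S1 `&` hbdU Pos S2 = fset0 ->
  exists Y Z, [/\ is_cell k Y /\ is_cell k Z,
    degenerate i.+1 Y /\ degenerate i.+1 Z,
    (forall e, Y i.+1 e = S1) /\ (forall e, Z i.+1 e = S2),
    layers_cmp i Y Z & X = layers_comp i Y Z].
Proof.
move=> ik cX dX d12 E i12.
have [gX eX _] := cell_glue Neg cX ik; rewrite -E in gX eX.
have sw := @swappable_all P tf.
have cXi := cell_layer Neg cX (ltnW ik).
have [g1 g2 g12] := gluable_split d12 i12 gX.
have [_ cM _] := glue tf (sw i) cXi g1.
set M := act S1 (X i Neg) in g2 g12 cM.
pose BY j e := if j < i then X j e else if e is Neg then X i Neg else M.
pose BZ j e := if j < i then X j e else if e is Neg then M else X i Pos.
have cY : is_cell i.+1 (with_top i.+1 BY S1).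
  apply: glue_cell => //; rewrite /BY ltnn //.
  by rewrite (eq_with_top (B := X)) // => j e ->.
have cZ : is_cell i.+1 (with_top i.+1 BZ S2).
  apply: glue_cell => //; rewrite /BZ ltnn //.
    by rewrite (eq_with_top (B := X)) // => j e ->.
  by rewrite g12 eX.
exists (with_top i.+1 BY S1), (with_top i.+1 BZ S2); split.
- by split; apply: cell_leq ik _.
- by split=> j e ij; rewrite with_top_gt.
- by split=> e; rewrite with_topE.
- apply: cmpP => [j e ji|].
    by rewrite !with_top_lt ?(ltn_trans ji) // /BY /BZ ji.
  by rewrite !with_top_lt // /BY /BZ ltnn.
- apply: layersP => l e; case: (ltngtP l i) => [li|li|->].
  + by rewrite layers_comp_lt // with_top_lt ?(ltn_trans li) // /BY li.
  + rewrite layers_comp_gt //; move: li; rewrite leq_eqVlt => /predU1P[<-|il].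
      rewrite !with_topE E; case: e => //.
      by rewrite (degenerate_sign cX dX).
    by rewrite !with_top_gt // dX // fsetU0.
  + by case: e; rewrite ?layers_comp_neg ?layers_comp_pos with_top_lt // /BY /BZ ltnn.
Qed.

(* An item is an i-dimensional context around the atom of u. *)
Definition is_item i u X := forall j e, i < j -> X j e = atom u j e.

(** The layer i+1 of an item is the atom's, whose strict source must be present in the i-source and
    whose strict target survives in the i-target. *)
Lemma item_atom_sub i k u X e : i < k -> i < hdim u -> is_cell k X -> is_item i u X ->
  atom u i e `<=` X i e.
Proof.
move=> ik iu cX iX; have [[_ _ sX] eX _] := cell_glue Neg cX ik.
rewrite iX // in sX eX; case: e.
  by rewrite -(atom_strict tf Neg Neg iu).
rewrite -(atom_strict tf Pos Neg iu) eX /act /=; clear; fset_solve.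
Qed.

(** The i-layer opposite to [T] is the one provided by [swappable], used here for atoms of any
    dimension above [i]. The higher layers are copied from the atom, where they are already known to
    be gluable. *)
Lemma item_exists i u A T e : i < hdim u -> is_cell i (with_top i A T) ->
  atom u i e `<=` T ->
  exists X, [/\ is_cell (hdim u) X, is_item i u X & layers_bd e i X = with_top i A T].
Proof.
move=> iu cT sT.
have sw := @swappable_all P tf.
have [dT cT'] := sw i A T u e iu cT sT.
set T' := _ `|` _ in cT'.
have ET' : T' = T `\` atom u i e `|` atom u i (opp_sign e) by [].
clearbody T'.
pose X j e' := if j < i then A j e' else
  if j == i then (match e, e' with Neg, Neg | Pos, Pos => T | _, _ => T' end)
  else atom u j e'.
have Xlt j e' : j < i -> X j e' = A j e' by rewrite /X => ->.
have Xe : X i e = T by rewrite /X ltnn eqxx; case: (e).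
have Xe' : X i (opp_sign e) = T' by rewrite /X ltnn eqxx; case: (e).
have Xgt j e' : i < j -> X j e' = atom u j e'.
  by move=> ij; rewrite /X ltnNge (ltnW ij) gtn_eqF.
clearbody X.
have da := atom_disj tf iu.
have XN : X i Pos = X i Neg `\` atom u i Neg `|` atom u i Pos.
  by clear - Xe Xe' dT da sT ET'; case: e Xe Xe' dT sT ET' => /= -> -> dT sT ET' //; fset_solve.
have sN : atom u i Neg `<=` X i Neg.
  by clear - Xe Xe' sT ET'; case: e Xe Xe' sT ET' => /= E1 E2; rewrite ?E1 ?E2 => sT ET' //; fset_solve.
have cN : is_cell i (with_top i X (X i Neg)).
  have WX e' : with_top i X (X i e') = with_top i A (X i e') by apply: eq_with_top.
  by rewrite WX; move: Xe Xe' cT cT'; case: (e) => /= E1 E2; rewrite ?E1 ?E2.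
have gN e' : gluable i (X i Neg) (atom u i.+1 e').
  split; first by move=> v; apply: atom_hdim.
    exact: atom_fork_free.
  by rewrite atom_strict.
have c1 e' : is_cell i.+1 (with_top i.+1 X (X i.+1 e')).
  apply: glue_cell => //; rewrite (Xgt i.+1) //.
  have [p _ _] := glue tf (sw i) cN (gN e').
  by rewrite act_disj // !atom_strict.
have iX : is_item i u X := Xgt.
have [au1 au2 au3] := tf_relevance tf u.
have cX j e' : i < j -> j <= hdim u -> is_cell j (with_top j X (X j e')).
  elim: j e' => // j IH e'; rewrite ltnS leq_eqVlt => /predU1P[<- _|ij ju] //.
  apply: glue_cell => //; first exact: IH (ltnW ju).
    rewrite !Xgt //; last exact: ltnW.
    by have [] := cell_glue e' (tf_relevance tf u) ju.
  rewrite !Xgt //; last exact: ltnW.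
  by have [] := cell_glue e' (tf_relevance tf u) ju.
exists X; split=> //.
  apply: cell_of_top; last exact: cX.
    by move=> j e' uj; rewrite Xgt ?atom_gt // (ltn_trans iu).
  by rewrite !Xgt // !atom_top.
rewrite layers_bdE Xe; exact: eq_with_top.
Qed.

(** The cut is made around the segment [atom u i.+1 Neg] in the (i+1)-source. The resulting
    composite has this (i+1)-source and the layers of the atom above it, so it is [X] by
    [cell_det]. *)
Lemma item_split i k u X : i.+1 < hdim u -> hdim u <= k -> is_cell k X ->
  is_item i.+1 u X ->
  exists Y X' Z, [/\ [/\ is_cell k Y, is_cell k X' & is_cell k Z],
    degenerate i.+1 Y /\ degenerate i.+1 Z, is_item i u X',
    layers_cmp i Y X' /\ layers_cmp i X' Z
  & X = layers_comp i Y (layers_comp i X' Z)].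
Proof.
move=> iu uk cX iX; have i1k : i.+1 < k := leq_trans iu uk.
have ik : i < k := ltnW i1k.
have iu' := ltnW iu.
set T := X i.+1 Neg; set S := atom u i.+1 Neg.
have sST : S `<=` T := item_atom_sub Neg i1k iu cX iX.
have cT := is_cell_bd Neg i1k cX.
have seg : segment (mem T) S.
  have E : top (mk_cell cT) = T by rewrite /top /= layers_bd_eq.
  by rewrite -E; apply: (tf_segment tf) => //; rewrite E.
have [dU dS UE iU iS] := segment_split sST seg.
set U := lower_part T S in dU dS UE iU iS.
set V := T `\` (U `|` S) in dU dS UE iU iS.
have cT' := cell_leq (ltnW i1k) cT.
(* [cell_split] does not apply to [X], which may have layers above i+1, but to its (i+1)-source,
   which is cut into [Y], [W'] and [Z] with tops [U], [S] and [V]. *)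
have [|Y [W [[cY cW] [dY dW] [Y1 W1] YW BE]]] :=
    cell_split ik cT' (@degenerate_bd _ _ _ _) dU _ iU.
  by rewrite layers_bd_eq.
have [|W' [Z [[cW' cZ] [dW' dZ] [W'1 Z1] WZ WE]]] := cell_split ik cW dW dS _ iS.
  by rewrite W1.
have [[_ _ sW'] eW' _] := cell_glue Neg cW' ik.
rewrite W'1 in sW' eW'; rewrite (atom_strict tf Neg Neg iu') in sW'.
(* The middle piece [W'] is replaced by an item with the same i-source; their i-targets agree, since
   [X'] also has [S] as its source layer in dimension i+1. *)
have [X' [cX' iX' bX']] := item_exists iu' (cell_layer Neg cW' (ltnW ik)) sW'.
rewrite -layers_bdE in bX'.
have cX'k := cell_leq uk cX'.
have X'W' j e : j < i -> X' j e = W' j e.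
  move=> ji; have := congr1 (fun F : layers P => F j e) bX'.
  by rewrite /= !layers_bd_lt.
have X'P : X' i Pos = W' i Pos.
  have := congr1 (fun F : layers P => F i Neg) bX'; rewrite /= !layers_bd_eq => E.
  by have [_ -> _] := cell_glue Neg cX' iu'; rewrite iX' // E eW'.
have YX' : layers_cmp i Y X'.
  by rewrite /layers_cmp YW bX' WE bd_comp_neg.
have X'Z : layers_cmp i X' Z.
  apply: cmpP => [j e ji|]; first by rewrite X'W' // (cmp_lt _ WZ).
  by rewrite X'P (cmp_eq WZ).
exists Y, X', Z; split=> //.
have [cX'Z _ _] := comp_cell ik cX'k cZ X'Z.
have [|cYX'Z _ _] := comp_cell (Y := layers_comp i X' Z) ik cY cX'Z.
  by rewrite /layers_cmp bd_comp_neg.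
apply: (cell_det (e := Neg) cX cYX'Z i1k).
  move=> j e ij; rewrite iX // !layers_comp_gt ?(ltnW ij) //.
  by rewrite dY // dZ // iX' ?(ltnW ij) // fset0U fsetU0.
rewrite BE; apply: layersP => l e; case: (ltngtP l i) => [li|li|->].
- by rewrite layers_bd_lt ?(ltn_trans li) // !layers_comp_lt.
- move: li; rewrite leq_eqVlt => /predU1P[<-|li].
    by rewrite layers_bd_eq !layers_comp_gt // WE layers_comp_gt // Y1 W'1 !Z1 Y1 iX'.
  by rewrite layers_bd_gt // layers_comp_gt ?dY ?dW ?fsetU0 // ltnW.
- rewrite layers_bd_lt // WE; case: e; first by rewrite !layers_comp_neg.
  by rewrite !layers_comp_pos.
Qed.

End Composition.

(** * Truncations of strict categories *)

Section Truncation.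
Variables (N : option nat) (C : cat_data N) (n : nat) (Hn : below N n).

Lemma trunc_composable i k (H : i < k) (x y : trunc C Hn k) :
  composable H x y <-> composable H (val x) (val y).
Proof. by split=> [/(congr1 val)|E]; [|apply: val_inj]. Qed.

Lemma trunc_idcn i d (H : below (Some n) (d + i)) (H' : below N (d + i))
  (x : trunc C Hn i) : val (idcn H x) = idcn H' (val x).
Proof.
elim: d H H' => //= d IH H H'.
by rewrite (IH _ (belowW H')); congr idc; apply: bool_irrelevance.
Qed.

Lemma trunc_strict : is_strict_cat C -> is_strict_cat (trunc C Hn).
Proof.
case=> S1 S2 S3 S4 S5 S6 S7 S8 S9 S10 S11; split.
- by move=> k [].
- by move=> e e' i j k Hij Hjk Hik x; apply: val_inj; apply: S2.
- by move=> e k H Hk x; apply: val_inj; apply: S3.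
- by move=> i k H x y /trunc_composable c; apply: val_inj; apply: S4.
- by move=> i k H x y /trunc_composable c; apply: val_inj; apply: S5.
- by move=> e i j k Hij Hjk Hik x y /trunc_composable c; apply: val_inj; apply: S6 c.
- move=> i d H Hd x; apply: val_inj => /=.
  by rewrite (trunc_idcn _ (below_le Hn Hd)); apply: S7.
- move=> i d H Hd x; apply: val_inj => /=.
  by rewrite (trunc_idcn _ (below_le Hn Hd)); apply: S8.
- move=> i k H x y z /trunc_composable c /trunc_composable c'.
  by apply: val_inj; apply: S9.
- move=> i j k Hij Hjk Hik x x' y y' /trunc_composable c1 /trunc_composable c2.
  by move=> /trunc_composable c3; apply: val_inj; apply: S10.
- by move=> i k H Hk x y /trunc_composable c; apply: val_inj; apply: S11.
Qed.

End Truncation.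

(** * The strict omega-category of cells *)

Section CellCategory.
Variable P : hypergraph.
Hypothesis tf : torsion_free P.
Let C := CellCat P.

Lemma cellP k (x : cell P k) : is_cell k (val x).
Proof. exact: asboolW (valP x). Qed.

Definition cmp i k (x y : cell P k) := layers_cmp i (val x) (val y).

Lemma composableE i k (H : i < k) (x y : C k) : composable H x y <-> cmp i x y.
Proof. by split=> [/(congr1 val)|E]; [|apply: val_inj]. Qed.

(** [ccomp] falls back on its first argument when the formula for the composite does not define a
    cell; [comp_cell] excludes this for composable cells. *)
Lemma val_ccomp i k (H : i < k) (x y : C k) : cmp i x y ->
  val (ccomp i x y) = layers_comp i (val x) (val y).
Proof.
move=> c; rewrite /= val_insubd; case: ifP => // /asboolP[].
by have [] := comp_cell tf H (cellP x) (cellP y) c.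
Qed.

Lemma val_bd e i k (H : i < k) (x : C k) : val (bd e H x) = layers_bd e i (val x).
Proof. by []. Qed.

Lemma val_idc k (H : below None k.+1) (x : C k) : val (idc H x) = val x.
Proof. by []. Qed.

Lemma val_idcn i d (H : below None (d + i)) (x : C i) : val (idcn H x) = val x.
Proof. by elim: d H => //= d IH H; apply: IH. Qed.

Lemma bd_id e k (X : layers P) : is_cell k X -> layers_bd e k X = X.
Proof. by move=> cX; rewrite layers_bdE with_top_id. Qed.

Lemma layers_bd_sign e i (X : layers P) : layers_bd e i X i Neg = layers_bd e i X i Pos.
Proof. by rewrite !layers_bd_eq. Qed.

Theorem CellCat_strict : is_strict_cat C.
Proof.
split.
- by [].
- by move=> e e' i j k Hij Hjk Hik x; apply: val_inj; apply: layers_bd_bd.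
- by move=> e k H Hk x; apply: val_inj; apply: bd_id; apply: cellP.
- move=> i k H x y /composableE c; apply: val_inj => /=.
  by rewrite (val_ccomp H c) bd_comp_neg.
- move=> i k H x y /composableE c; apply: val_inj => /=.
  by rewrite (val_ccomp H c) bd_comp_pos.
- move=> e i j k Hij Hjk Hik x y /composableE c; apply: val_inj.
  have c' : cmp i (bd e Hjk x) (bd e Hjk y).
    by rewrite /cmp !val_bd /layers_cmp !layers_bd_bd.
  by rewrite val_bd (val_ccomp Hik c) bd_comp_gt // (val_ccomp Hij c').
- move=> i d H Hd x; have iE := val_idcn Hd (bd Neg H x).
  have c : cmp i (idcn Hd (bd Neg H x)) x.
    by rewrite /cmp iE /= /layers_cmp; apply: layersP => j e;
      rewrite /layers_bd; case: ltngtP => // ->; rewrite ltnn.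
  apply: val_inj; rewrite (val_ccomp H c) iE /=.
  move: c; rewrite /cmp iE => c; apply: comp_idl c _.
    exact: degenerate_bd.
  by rewrite /= layers_bd_sign.
- move=> i d H Hd x; have iE := val_idcn Hd (bd Pos H x).
  have c : cmp i x (idcn Hd (bd Pos H x)).
    by rewrite /cmp iE /= /layers_cmp; apply: layersP => j e;
      rewrite /layers_bd; case: ltngtP => // ->; rewrite ltnn.
  apply: val_inj; rewrite (val_ccomp H c) iE /=.
  move: c; rewrite /cmp iE => c; apply: comp_idr c _.
    exact: degenerate_bd.
  by rewrite /= layers_bd_sign.
- move=> i k H x y z /composableE c1 /composableE c2.
  have c3 : cmp i (ccomp i x y) z.
    by rewrite /cmp (val_ccomp H c1) /layers_cmp bd_comp_pos.
  have c4 : cmp i x (ccomp i y z).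
    by rewrite /cmp (val_ccomp H c2) /layers_cmp bd_comp_neg.
  apply: val_inj; rewrite !(val_ccomp H) //; exact: layers_compA.
- move=> i j k Hij Hjk Hik x x' y y' /composableE c1 /composableE c2 /composableE c3.
  have c3' : cmp i x' y'.
    by rewrite /cmp /layers_cmp -(cmp_bd Pos c1) // -(cmp_bd Neg c2).
  have c4 : cmp i (ccomp j x x') (ccomp j y y').
    by rewrite /cmp /layers_cmp (val_ccomp Hjk c1) (val_ccomp Hjk c2) !bd_comp_lt.
  have c5 : cmp j (ccomp i x y) (ccomp i x' y').
    rewrite /cmp /layers_cmp (val_ccomp Hik c3) (val_ccomp Hik c3') !bd_comp_gt //.
    by congr layers_comp.
  apply: val_inj; rewrite !(val_ccomp Hik) // !(val_ccomp Hjk) //.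
  by rewrite !(val_ccomp Hik) // layers_exchange.
- move=> i k H Hk x y /composableE c; apply: val_inj.
  by rewrite val_idc (val_ccomp H c) (val_ccomp (leqW H)) .
Qed.

End CellCategory.

(** * Evaluation of cells in a cocone *)

Section IteratedIdentities.
Variables (N : option nat) (C : cat_data N).
Hypothesis SC : is_strict_cat C.

Lemma bd_idcn e i d (H : i < d + i) (Hd : below N (d + i)) (z : C i) :
  bd e H (idcn Hd z) = z.
Proof.
case: d H Hd => [|d] H Hd; first by exfalso; rewrite ltnn in H.
elim: d H Hd => [|d IH] H Hd /=.
  by have -> : H = ltnSn i by [apply: bool_irrelevance]; rewrite (bd_idc SC).
have Hi : i < d.+1 + i by rewrite addSn ltnS leq_addl.
rewrite -(bd_bd SC e Neg Hi (ltnSn _)) (bd_idc SC).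
exact: IH.
Qed.

(** [idcn] lands in dimension [d + i]; the transport along [E] makes the notion available for a cell
    of arbitrary dimension [k]. *)
Definition iterated_id i k (z : C k) : Prop :=
  exists d (E : d + i = k) (H : below N (d + i)) z0, z = eq_rect _ C (idcn H z0) _ E.

Lemma iterated_id0 i (z : C i) : iterated_id i z.
Proof.
have H : below N (0 + i) := cells_below SC z.
by exists 0, erefl, H, z.
Qed.

Lemma iterated_idS i k (H : below N k.+1) (z : C k) :
  iterated_id i z -> iterated_id i (idc H z).
Proof.
move=> [d [E [H0 [z0 Ez]]]]; subst k; rewrite {}Ez /=.
exists d.+1, erefl, H, z0 => /=; congr (idc _ (idcn _ _)); exact: bool_irrelevance.
Qed.

Lemma comp_iterated_idl i k (H : i < k) (z x : C k) : iterated_id i z ->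
  composable H z x -> ccomp i z x = x.
Proof.
move=> [d [E [H0 [z0 Ez]]]]; subst k; rewrite {}Ez /= /composable bd_idcn => ->.
exact: (ccomp_idl SC).
Qed.

Lemma comp_iterated_idr i k (H : i < k) (z x : C k) : iterated_id i z ->
  composable H x z -> ccomp i x z = x.
Proof.
move=> [d [E [H0 [z0 Ez]]]]; subst k; rewrite {}Ez /= /composable bd_idcn => <-.
exact: (ccomp_idr SC).
Qed.

End IteratedIdentities.

(** * Pairs of a cell and a value lying over it *)

Section Pairs.
Variables (P : hypergraph) (tf : torsion_free P) (n : nat).
Variable D : cocone (CellExt tf n).
Hypothesis HD : is_cocone D.
Let C := CellCat P.
Let E := cc_cat D.
Let SC : is_strict_cat C := CellCat_strict tf.
Let SE : is_strict_cat E := cc_strict HD.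

Definition inc i (Hi : i <= n) (x : cell P i) : E i :=
  val (cc_inc D (exist _ x Hi : ext_cat (CellExt tf n) i)).

Lemma inc_bd e i k (H : i < k) (Hk : k <= n) (Hi : i <= n) (x : C k) :
  inc Hi (bd e H x) = bd e H (inc Hk x).
Proof.
have /(congr1 val) /= <- := functor_bd (cc_functor HD) e H (exist _ x Hk : CellLe P n k).
by rewrite /inc; congr (val (cc_inc D _)); apply: val_inj.
Qed.

Lemma inc_idc k (H : below None k.+1) (Hk : k.+1 <= n) (Hk' : k <= n)
    (H' : below (Some n.+1) k.+1) (x : C k) :
  inc Hk (idc H x) = idc H' (inc Hk' x).
Proof.
have := functor_idc (cc_functor HD) (Hk : below (Some n) k.+1) (exist _ x Hk' : CellLe P n k).
move=> /(congr1 val) /=.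
have -> : below_le (leqnSn n : below (Some n.+1) n) Hk = H' by apply: bool_irrelevance.
move=> <-; rewrite /inc; congr (val (cc_inc D _)); exact: val_inj.
Qed.

Lemma inc_ccomp i k (H : i < k) (Hk : k <= n) (x y : C k) : cmp i x y ->
  inc Hk (ccomp i x y) = ccomp i (inc Hk x) (inc Hk y).
Proof.
move=> c; have c' : @composable _ (CellLe P n) i k H (exist _ x Hk) (exist _ y Hk).
  by apply: val_inj; apply/(composableE H).
have /(congr1 val) /= <- := functor_ccomp (cc_functor HD) c'.
by rewrite /inc; congr (val (cc_inc D _)); apply: val_inj.
Qed.

Definition pair_cell : Type := cell P n.+1 * E n.+1.
Implicit Types (p q r : pair_cell) (x y : cell P n.+1).

(* A cell of E together with the cell whose evaluation it is meant to be. *)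
Definition lies_over p := forall e i (H : i < n.+1) (Hi : i <= n),
  bd e H p.2 = inc Hi (bd e H (p.1 : C n.+1)).

Definition cmpp i p q := cmp i p.1 q.1.

Definition compp i p q : pair_cell :=
  (ccomp i (p.1 : C n.+1) (q.1 : C n.+1), ccomp i p.2 q.2).

Definition deg i x := degenerate i (val x).

(** Intended for [x] degenerate above dimension n: such an [x] is the identity on its n-source, and
    its value is forced by the functor [inc]. *)
Definition emb x : pair_cell :=
  (x, idc (leqnn n.+1 : below (Some n.+1) n.+1) (inc (leqnn n) (bd Neg (ltnSn n) (x : C n.+1)))).

Lemma val_compp i p q : i <= n -> cmpp i p q ->
  val (compp i p q).1 = layers_comp i (val p.1) (val q.1).
Proof. by move=> Hi c; apply: (val_ccomp tf (Hi : i < n.+1)). Qed.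

Lemma over_composable i (H : i < n.+1) p q : lies_over p -> lies_over q -> cmpp i p q ->
  composable H p.2 q.2.
Proof.
move=> op oq /(composableE H) c; rewrite /composable (op _ _ _ H) (oq _ _ _ H).
by congr inc.
Qed.

Lemma over_comp i p q : i <= n -> lies_over p -> lies_over q -> cmpp i p q -> lies_over (compp i p q).
Proof.
move=> Hi0 op oq c e l H Hl; have Hi : i < n.+1 := Hi0.
have c1 := over_composable Hi op oq c.
have c2 := (composableE Hi p.1 q.1).2 c.
change (bd e H (ccomp i p.2 q.2) =
  inc Hl (bd e H (ccomp i (p.1 : C n.+1) (q.1 : C n.+1)))).
case: (ltngtP l i) => [li|il|li].
- rewrite -(bd_bd SE e Neg li Hi H) (bd_ccomp_src SE c1).
  rewrite -(bd_bd SC e Neg li Hi H) (bd_ccomp_src SC c2).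
  by rewrite (bd_bd SE e Neg li Hi H) (bd_bd SC e Neg li Hi H) (op _ _ _ Hl).
- rewrite (bd_ccomp SE e il H c1) (op _ _ _ Hl) (oq _ _ _ Hl).
  rewrite (bd_ccomp SC e il H c2) (inc_ccomp il) //.
  by apply/(composableE il); rewrite /composable !(bd_bd SC _ _ il H Hi).
- subst l; have -> : H = Hi by apply: bool_irrelevance.
  case: e; first by rewrite (bd_ccomp_src SE c1) (bd_ccomp_src SC c2) (op _ _ _ Hl).
  by rewrite (bd_ccomp_tgt SE c1) (bd_ccomp_tgt SC c2) (oq _ _ _ Hl).
Qed.

Lemma comppA i p q r : i <= n -> lies_over p -> lies_over q -> lies_over r ->
  cmpp i p q -> cmpp i q r -> compp i (compp i p q) r = compp i p (compp i q r).
Proof.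
move=> Hi op oq or pq qr; have Hi' : i < n.+1 := Hi; congr pair.
  by apply: (@ccompA _ _ SC i n.+1 Hi' p.1 q.1 r.1); apply/composableE.
by apply: (@ccompA _ _ SE i n.+1 Hi' p.2 q.2 r.2); apply: over_composable.
Qed.

Lemma compp_exchange i j p p' q q' : i < j -> j <= n ->
  lies_over p -> lies_over p' -> lies_over q -> lies_over q' ->
  cmpp j p p' -> cmpp j q q' -> cmpp i p q ->
  compp i (compp j p p') (compp j q q') = compp j (compp i p q) (compp i p' q').
Proof.
move=> ij Hj op op' oq oq' pp qq pq; have Hj' : j < n.+1 := Hj.
have Hi : i < n.+1 := ltn_trans ij Hj'; congr pair.
  apply: (@ccomp_exchange _ _ SC i j n.+1 ij Hj' Hi p.1 p'.1 q.1 q'.1);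
    exact/composableE.
apply: (@ccomp_exchange _ _ SE i j n.+1 ij Hj' Hi p.2 p'.2 q.2 q'.2);
  exact: over_composable.
Qed.

Lemma degenerate_idc k (y : C k.+1) : degenerate k (val y) -> y = idc (isT : below None k.+1) (bd Neg (ltnSn k) y).
Proof.
move=> dy; apply: val_inj; rewrite val_idc val_bd.
apply: layersP => l e; case: (ltngtP l k) => [li|li|->].
- by rewrite layers_bd_lt.
- by rewrite layers_bd_gt // dy.
- by rewrite layers_bd_eq; case: e; rewrite // (degenerate_sign (cellP y) dy).
Qed.

Lemma emb_over x : deg n x -> lies_over (emb x).
Proof.
move=> dx e i H Hi.
change (bd e H (idc (leqnn n.+1 : below (Some n.+1) n.+1)
    (inc (leqnn n) (bd Neg (ltnSn n) (x : C n.+1)))) = inc Hi (bd e H (x : C n.+1))).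
rewrite [x in RHS](degenerate_idc dx).
move: (bd Neg _ _) => z; set y := inc _ z.
case: (ltngtP i n) => [ni|ni|ni].
- rewrite -(bd_bd SE e Neg ni (ltnSn n)) (bd_idc SE).
  rewrite -(bd_bd SC e Neg ni (ltnSn n)) (bd_idc SC).
  by rewrite -inc_bd.
- by exfalso; move: (leq_trans ni Hi); rewrite ltnn.
- subst i; have -> : H = ltnSn n by apply: bool_irrelevance.
  rewrite (bd_idc SE) (bd_idc SC) /y; congr inc; exact: bool_irrelevance.
Qed.

Lemma inc_iterated_id i k (Hk : k <= n) (y : C k) : i <= k ->
  degenerate i (val y) -> iterated_id i (inc Hk y).
Proof.
elim: k Hk y => [|k IH] Hk y.
  by rewrite leqn0 => /eqP E0; subst i => _; apply: iterated_id0.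
rewrite leq_eqVlt => /predU1P[E0|ik] dy; first by subst i; apply: iterated_id0.
have Ey := degenerate_idc (degenerateW (ik : i <= k) dy).
rewrite Ey (@inc_idc _ _ _ (ltnW Hk) (leqW Hk)); apply: iterated_idS; apply: IH => // j e ij.
have [jk|jk] := ltnP j k; first by rewrite val_bd layers_bd_lt // dy.
move: jk; rewrite leq_eqVlt => /predU1P[kj|kj]; last by rewrite val_bd layers_bd_gt.
by subst j; rewrite val_bd layers_bd_eq dy.
Qed.

Lemma emb_iterated_id i x : i <= n -> deg i x -> iterated_id i (emb x).2.
Proof.
move=> Hi dx; apply: iterated_idS; apply: inc_iterated_id => // j e ij.
rewrite val_bd; case: (ltngtP j n) => [jn|jn|jn].
- by rewrite layers_bd_lt // dx.
- by rewrite layers_bd_gt.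
- by rewrite jn layers_bd_eq dx // -jn.
Qed.

Lemma emb_idl i x p : i <= n -> deg i x -> lies_over p -> cmp i x p.1 ->
  compp i (emb x) p = p.
Proof.
move=> Hi dx op c; rewrite [RHS]surjective_pairing; congr pair.
  apply: val_inj; rewrite (val_ccomp tf (Hi : i < n.+1)) //.
  by apply: comp_idl => //; apply: (degenerate_sign (cellP x)) => //; apply: ltnW.
apply: (@comp_iterated_idl _ _ SE i n.+1 Hi (emb x).2 p.2); first exact: emb_iterated_id.
by apply: over_composable => //; apply: emb_over; apply: degenerateW dx.
Qed.

Lemma emb_idr i x p : i <= n -> deg i x -> lies_over p -> cmp i p.1 x ->
  compp i p (emb x) = p.
Proof.
move=> Hi dx op c; rewrite [RHS]surjective_pairing; congr pair.
  apply: val_inj; rewrite (val_ccomp tf (Hi : i < n.+1)) //.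
  by apply: comp_idr => //; apply: (degenerate_sign (cellP x)) => //; apply: ltnW.
apply: (@comp_iterated_idr _ _ SE i n.+1 Hi (emb x).2 p.2); first exact: emb_iterated_id.
by apply: over_composable => //; apply: emb_over; apply: degenerateW dx.
Qed.

Lemma deg_comp i j x y : i <= j -> i <= n -> deg j x -> deg j y -> cmp i x y ->
  deg j (ccomp i (x : C n.+1) y).
Proof.
move=> ij Hi dx dy c; rewrite /deg (val_ccomp tf (Hi : i < n.+1)) //.
exact: degenerate_comp.
Qed.

(** Below n this is functoriality of [inc] and of identities; for [i = n] both sides reduce to the
    second factor by the unit law. *)
Lemma emb_comp i x y : i <= n -> deg n x -> deg n y -> cmp i x y ->
  emb (ccomp i (x : C n.+1) y) = compp i (emb x) (emb y).
Proof.
move=> Hi dx dy c.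
have c2 := (composableE (Hi : i < n.+1) x y).2 c.
case: (ltngtP i n) => [ni|ni|ni].
- have c3 : composable ni (bd Neg (ltnSn n) (x : C n.+1)) (bd Neg (ltnSn n) (y : C n.+1)).
    by rewrite /composable !(bd_bd SC _ _ ni (ltnSn n) Hi).
  have c4 : composable ni (inc (leqnn n) (bd Neg (ltnSn n) (x : C n.+1)))
      (inc (leqnn n) (bd Neg (ltnSn n) (y : C n.+1))).
    by rewrite /composable -!(inc_bd _ ni (leqnn n) (ltnW ni)); congr inc.
  congr pair; rewrite [RHS](esym (idc_ccomp SE _ c4)); congr idc.
  by rewrite (bd_ccomp SC _ ni _ c2) (inc_ccomp ni) //; apply/(composableE ni).
- by exfalso; move: (leq_trans ni Hi); rewrite ltnn.
- subst i; rewrite [RHS]emb_idl //; last exact: emb_over.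
  congr emb; apply: val_inj; rewrite (val_ccomp tf (Hi : n < n.+1)) //.
  by apply: comp_idl => //; apply: (degenerate_sign (cellP x)) => //; apply: ltnW.
Qed.

(* Meaningful for i <= n only. *)
Definition bd_id_cell e i x : cell P n.+1 := insubd x (layers_bd e i (val x)).

Lemma val_bd_id_cell e i x : i <= n -> val (bd_id_cell e i x) = layers_bd e i (val x).
Proof.
move=> Hi; rewrite val_insubd; case: asboolP => // -[].
by apply: (cell_leq (leqW Hi)); apply: is_cell_bd (cellP x).
Qed.

Lemma deg_bd_id_cell e i x : i <= n -> deg i (bd_id_cell e i x).
Proof. by move=> Hi; rewrite /deg val_bd_id_cell //; apply: degenerate_bd. Qed.

Lemma gen_over g : lies_over (atom_cell tf g, cc_gen D g).
Proof.
move=> e i H Hi; change (bd e H (cc_gen D g) = inc Hi (bd e H (atom_cell tf g : C n.+1))).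
have Hn : bd e (ltnSn n) (cc_gen D g) =
    inc (leqnn n) (bd e (ltnSn n) (atom_cell tf g : C n.+1)) := cc_gen_bd HD e g.
case: (ltngtP i n) => [ni|ni|ni].
- rewrite -(bd_bd SE e e ni (ltnSn n)) Hn.
  by rewrite -(bd_bd SC e e ni (ltnSn n)) (inc_bd _ _ (leqnn n)).
- by exfalso; move: (leq_trans ni Hi); rewrite ltnn.
- subst i; have -> : H = ltnSn n by apply: bool_irrelevance.
  by rewrite Hn; congr inc; apply: bool_irrelevance.
Qed.

End Pairs.

(** * Values of items and their closure under whiskering *)

Section Evaluation.
Variables (P : hypergraph) (tf : torsion_free P) (n : nat).
Variable D : cocone (CellExt tf n).
Hypothesis HD : is_cocone D.
Let C := CellCat P.
Implicit Types (p q r : pair_cell D) (x y : cell P n.+1) (e : sign) (i j l : nat).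
Implicit Types (S T : {fset P}).

Definition pbd e i p := layers_bd e i (val p.1).

Lemma cmppE i p q : cmpp i p q = (pbd Pos i p = pbd Neg i q).
Proof. by []. Qed.

Lemma pbd_src i p q : i <= n -> cmpp i p q -> pbd Neg i (compp i p q) = pbd Neg i p.
Proof. by move=> Hi c; rewrite /pbd val_compp // bd_comp_neg. Qed.

Lemma pbd_tgt i p q : i <= n -> cmpp i p q -> pbd Pos i (compp i p q) = pbd Pos i q.
Proof. by move=> Hi c; rewrite /pbd val_compp // bd_comp_pos. Qed.

Lemma pbd_gt e i j p q : i < j -> i <= n -> cmpp i p q ->
  pbd e j (compp i p q) = layers_comp i (pbd e j p) (pbd e j q).
Proof. by move=> ij Hi c; rewrite /pbd val_compp // bd_comp_gt. Qed.

Lemma pbd_lt e l i p q : l < i -> i <= n -> cmpp i p q ->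
  pbd e l (compp i p q) = pbd e l p.
Proof. by move=> li Hi c; rewrite /pbd val_compp // bd_comp_lt. Qed.

Lemma cmpp_bd e l i p q : l < i -> cmpp i p q -> pbd e l p = pbd e l q.
Proof. by move=> li c; apply: cmp_bd c li. Qed.

Lemma pbd_id_lt e e' l i x : l < i -> i <= n ->
  pbd e l (emb D (bd_id_cell e' i x)) = pbd e l (emb D x).
Proof. by move=> li Hi; rewrite /pbd /= val_bd_id_cell // layers_bd_bd. Qed.

Lemma pbd_id_eq e e' i x : i <= n ->
  pbd e i (emb D (bd_id_cell e' i x)) = pbd e' i (emb D x).
Proof.
move=> Hi; rewrite /pbd /= val_bd_id_cell //; apply: layersP => j e''.
case: (ltngtP j i) => [ji|ji|->].
- by rewrite !layers_bd_lt.
- by rewrite !layers_bd_gt.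
- by rewrite !layers_bd_eq.
Qed.

Lemma pair_id_r i p : i <= n -> lies_over p ->
  p = compp i p (emb D (bd_id_cell Pos i p.1)).
Proof.
move=> Hi op; rewrite (emb_idr HD) //.
- exact: deg_bd_id_cell.
- by have /= := @pbd_id_eq Neg Pos i p.1 Hi; rewrite /pbd /= => E; rewrite /cmp /layers_cmp E.
Qed.

Lemma pair_id_l i p : i <= n -> lies_over p ->
  p = compp i (emb D (bd_id_cell Neg i p.1)) p.
Proof.
move=> Hi op; rewrite (emb_idl HD) //.
- exact: deg_bd_id_cell.
- by have /= := @pbd_id_eq Pos Neg i p.1 Hi; rewrite /pbd /= => E; rewrite /cmp /layers_cmp E.
Qed.

(* [Ev i p] says that p.1 is an i-dimensional context around the atom of a
   generator and that p.2 is a value obtained by interpreting this context. *)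
Fixpoint Ev i p : Prop :=
  match i with
  | 0 => exists g : gens P n.+1, p = (atom_cell tf g, cc_gen D g)
  | i'.+1 => exists u v q, [/\ deg i'.+1 u /\ deg i'.+1 v, Ev i' q,
      cmpp i' (emb D u) q, cmpp i' q (emb D v)
      & p = compp i' (emb D u) (compp i' q (emb D v))]
  end.

Lemma deg_top i x : i <= n -> deg i x -> deg n x.
Proof. exact: degenerateW. Qed.

Lemma Ev_spec i p : i <= n -> Ev i p ->
  lies_over p /\ exists g : gens P n.+1, is_item i (val g) (val p.1).
Proof.
elim: i p => [|i IH] p Hi /=.
  by move=> [g ->]; split; [apply: gen_over|exists g].
move=> [u [v [q [[du dv] Eq uq qv ->]]]].
have Hi' := ltnW Hi; have [oq [g ig]] := IH q Hi' Eq.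
have ou := emb_over HD (deg_top Hi du); have ov := emb_over HD (deg_top Hi dv).
have c : cmpp i (emb D u) (compp i q (emb D v)).
  by rewrite cmppE (pbd_src Hi' qv).
split; first by apply: over_comp => //; apply: over_comp.
exists g => j e ij; rewrite (val_compp Hi' c) (val_compp Hi' qv).
rewrite !layers_comp_gt ?(ltnW ij) // ig ?(ltnW ij) //=.
by rewrite du // dv // fset0U fsetU0.
Qed.

Lemma Ev_over i p : i <= n -> Ev i p -> lies_over p.
Proof. by move=> Hi /(Ev_spec Hi)[]. Qed.

Lemma Ev_not_deg i p : i <= n -> Ev i p -> ~ deg n p.1.
Proof.
move=> Hi /(Ev_spec Hi)[_ [g ig]] /(_ n.+1 Neg (ltnSn n)).
rewrite ig //; move: (val g) (eqP (valP g)) => u <-.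
by rewrite atom_top => /fsetP/(_ u); rewrite in_fset1 eqxx.
Qed.

(** Along the outermost dimension of the context, [c] is absorbed into its right end. Along a lower
    one, [c] is distributed over the three factors by exchange, and the inner item is handled by
    induction. *)
Lemma Ev_whisker_r i l p c : i <= n -> l < i -> Ev i p -> deg i c ->
  cmpp l p (emb D c) -> Ev i (compp l p (emb D c)).
Proof.
elim: i l p c => // i IH l p c Hi; rewrite ltnS => li.
have Hi' := ltnW Hi.
move=> [u [v [q [[du dv] Eq uq qv Ep]]]] dc; rewrite {}Ep.
have ou := emb_over HD (deg_top Hi du); have ov := emb_over HD (deg_top Hi dv).
have oc := emb_over HD (deg_top Hi dc); have oq := Ev_over Hi' Eq.
have uqv : cmpp i (emb D u) (compp i q (emb D v)) by rewrite cmppE [RHS](pbd_src Hi' qv).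
have oqv := over_comp HD Hi' oq ov qv.
move: li; rewrite leq_eqVlt => /predU1P[E|li].
  subst l => pc.
  have vc : cmpp i (emb D v) (emb D c).
    by move: pc; rewrite cmppE (pbd_tgt Hi' uqv) (pbd_tgt Hi' qv).
  have ovc := over_comp HD Hi' ov oc vc.
  exists u, (ccomp i (v : C n.+1) c), q.
  have Evc := emb_comp HD Hi' (deg_top Hi dv) (deg_top Hi dc) vc.
  have qvc : cmpp i q (emb D (ccomp i (v : C n.+1) c)).
    by rewrite Evc cmppE [RHS](pbd_src Hi' vc).
  split=> //; first by split=> //; apply: deg_comp.
  rewrite Evc -(comppA HD (p := q)) // (comppA HD Hi' ou oqv oc) //.
  by rewrite cmppE [LHS](pbd_tgt Hi' qv).
(* With [t] the identity on the i-target of [c], one has c = c *_i t *_i t, so exchange turns (u *_i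
   q *_i v) *_l c into (u *_l c) *_i (q *_l t) *_i (v *_l t). As [t] is degenerate above i, the
   induction hypothesis applies to q *_l t. *)
move=> pc; set t := bd_id_cell Pos i c; have Hl := ltn_trans li Hi.
have dt : deg i t by apply: deg_bd_id_cell.
have ot : lies_over (emb D t) by apply: (emb_over HD); apply: deg_top dt.
have ct : cmpp i (emb D c) (emb D t) by rewrite cmppE [RHS](pbd_id_eq _ _ _ Hi').
have tt : cmpp i (emb D t) (emb D t).
  by rewrite cmppE [LHS](pbd_id_eq _ _ _ Hi') [RHS](pbd_id_eq _ _ _ Hi').
have Et : compp i (emb D t) (emb D t) = emb D t by apply: (emb_idl HD).
have ott : lies_over (compp i (emb D t) (emb D t)) by rewrite Et.
have ctt : cmpp i (emb D c) (compp i (emb D t) (emb D t)) by rewrite Et.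
have Ec : compp i (emb D c) (emb D t) = emb D c by apply: (emb_idr HD).
have uc : cmpp l (emb D u) (emb D c).
  by move: pc; rewrite cmppE (pbd_lt _ li Hi' uqv).
have qt : cmpp l q (emb D t).
  by rewrite cmppE [LHS](esym (cmpp_bd _ li uq)) [RHS](pbd_id_lt _ _ _ li Hi').
have vt : cmpp l (emb D v) (emb D t).
  by rewrite cmppE [LHS](esym (cmpp_bd _ li qv)).
have Euc := emb_comp HD (ltnW Hl) (deg_top Hi du) (deg_top Hi dc) uc.
have Evt := emb_comp HD (ltnW Hl) (deg_top Hi dv) (deg_top Hi' dt) vt.
exists (ccomp l (u : C n.+1) c), (ccomp l (v : C n.+1) t), (compp l q (emb D t)).
split.
- split; apply: deg_comp => //; try exact: ltnW.
  + exact: leqW (ltnW li).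
  + exact: leqW (ltnW li).
  + exact: degenerateW dt.
- exact: IH.
- rewrite Euc; rewrite cmppE [LHS](pbd_gt _ li (ltnW Hl) uc) [RHS](pbd_gt _ li (ltnW Hl) qt).
  congr layers_comp; first exact: uq.
  exact: ct.
- rewrite Evt; rewrite cmppE [LHS](pbd_gt _ li (ltnW Hl) qt) [RHS](pbd_gt _ li (ltnW Hl) vt).
  by congr layers_comp.
- rewrite Euc Evt -[in LHS]Ec -[in LHS]Et.
  by rewrite (compp_exchange HD li Hi') // (compp_exchange HD li Hi').
Qed.

Lemma Ev_whisker_l i l p c : i <= n -> l < i -> Ev i p -> deg i c ->
  cmpp l (emb D c) p -> Ev i (compp l (emb D c) p).
Proof.
elim: i l p c => // i IH l p c Hi; rewrite ltnS => li.
have Hi' := ltnW Hi.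
move=> [u [v [q [[du dv] Eq uq qv Ep]]]] dc; rewrite {}Ep.
have ou := emb_over HD (deg_top Hi du); have ov := emb_over HD (deg_top Hi dv).
have oc := emb_over HD (deg_top Hi dc); have oq := Ev_over Hi' Eq.
have uqv : cmpp i (emb D u) (compp i q (emb D v)) by rewrite cmppE [RHS](pbd_src Hi' qv).
have oqv := over_comp HD Hi' oq ov qv.
move: li; rewrite leq_eqVlt => /predU1P[E|li].
  subst l => pc.
  have cu : cmpp i (emb D c) (emb D u).
    by move: pc; rewrite cmppE (pbd_src Hi' uqv).
  exists (ccomp i (c : C n.+1) u), v, q.
  have Ecu := emb_comp HD Hi' (deg_top Hi dc) (deg_top Hi du) cu.
  have cuq : cmpp i (emb D (ccomp i (c : C n.+1) u)) q.
    by rewrite Ecu cmppE [LHS](pbd_tgt Hi' cu).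
  split=> //; first by split=> //; apply: deg_comp.
  by rewrite Ecu (comppA HD Hi' oc ou oqv).
(* Again c = c *_i t *_i t, which now gives (c *_l u) *_i (t *_l q) *_i (t *_l v). *)
move=> pc; set t := bd_id_cell Pos i c; have Hl := ltn_trans li Hi.
have dt : deg i t by apply: deg_bd_id_cell.
have ot : lies_over (emb D t) by apply: (emb_over HD); apply: deg_top dt.
have ct : cmpp i (emb D c) (emb D t) by rewrite cmppE [RHS](pbd_id_eq _ _ _ Hi').
have tt : cmpp i (emb D t) (emb D t).
  by rewrite cmppE [LHS](pbd_id_eq _ _ _ Hi') [RHS](pbd_id_eq _ _ _ Hi').
have Et : compp i (emb D t) (emb D t) = emb D t by apply: (emb_idl HD).
have ott : lies_over (compp i (emb D t) (emb D t)) by rewrite Et.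
have ctt : cmpp i (emb D c) (compp i (emb D t) (emb D t)) by rewrite Et.
have Ec : compp i (emb D c) (emb D t) = emb D c by apply: (emb_idr HD).
have cu : cmpp l (emb D c) (emb D u).
  by move: pc; rewrite cmppE (pbd_lt _ li Hi' uqv).
have tq : cmpp l (emb D t) q.
  by rewrite cmppE [RHS](esym (cmpp_bd _ li uq)) [LHS](pbd_id_lt _ _ _ li Hi').
have tv : cmpp l (emb D t) (emb D v).
  by rewrite cmppE [RHS](esym (cmpp_bd _ li qv)).
have Ecu := emb_comp HD (ltnW Hl) (deg_top Hi dc) (deg_top Hi du) cu.
have Etv := emb_comp HD (ltnW Hl) (deg_top Hi' dt) (deg_top Hi dv) tv.
exists (ccomp l (c : C n.+1) u), (ccomp l (t : C n.+1) v), (compp l (emb D t) q).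
split.
- split; apply: deg_comp => //; try exact: ltnW.
  + exact: leqW (ltnW li).
  + exact: leqW (ltnW li).
  + exact: degenerateW dt.
- exact: IH.
- rewrite Ecu; rewrite cmppE [LHS](pbd_gt _ li (ltnW Hl) cu) [RHS](pbd_gt _ li (ltnW Hl) tq).
  congr layers_comp; first exact: ct.
  exact: uq.
- rewrite Etv; rewrite cmppE [LHS](pbd_gt _ li (ltnW Hl) tq) [RHS](pbd_gt _ li (ltnW Hl) tv).
  by congr layers_comp.
- rewrite Ecu Etv -[in LHS]Ec -[in LHS]Et.
  by rewrite (compp_exchange HD li Hi') // (compp_exchange HD li Hi').
Qed.

End Evaluation.

(** * Exchanging two consecutive items *)

Section Swap.
Variables (P : hypergraph) (tf : torsion_free P) (n : nat).
Variable D : cocone (CellExt tf n).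
Hypothesis HD : is_cocone D.
Implicit Types (p q r : pair_cell D) (x y : cell P n.+1) (e : sign) (i j l : nat).
Implicit Types (S T : {fset P}) (u v w : P) (X Y Z : layers P).

Definition pitem i u p := is_item i u (val p.1).

Lemma pitem_det e i u p q : i <= n -> pitem i u p -> pitem i u q ->
  pbd e i p = pbd e i q -> p.1 = q.1.
Proof.
move=> Hi ip iq pq; apply: val_inj.
apply: (cell_det (cellP p.1) (cellP q.1) Hi _ pq) => j e' ij.
by rewrite ip // iq.
Qed.

Lemma Ev_total i x (g : gens P n.+1) : i <= n -> is_item i (val g) (val x) ->
  exists2 p : pair_cell D, Ev i p & p.1 = x.
Proof.
have gn : hdim (val g) = n.+1 by apply/eqP/(valP g).
elim: i x => [|i IH] x Hi ix.
  exists (atom_cell tf g, cc_gen D g); first by exists g.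
  apply: val_inj => /=; apply: layersP => j e; case: j => [|j]; last first.
    by rewrite ix.
  (* In dimension 0 both sets are singletons, so the inclusion of the atom's layer is an equality
     and the item is the atom itself. *)
  apply/eqP; rewrite eqEfcard (item_atom_sub tf e (ltn0Sn n) _ (cellP x)) ?gn //.
  have [_ _ /(_ 0 e (leq0n _)) /= ->] := cellP x.
  by have /= -> := atom_fork_free tf e (leq0n (hdim (val g))).
have [||Y [X' [Z [[cY cX cZ] [dY dZ] iX [YX XZ] E]]]] :=
  item_split tf _ _ (cellP x) ix; rewrite ?gn //.
have [q Eq q1] := IH (mk_cell cX) (ltnW Hi) iX.
pose u := mk_cell cY; pose v := mk_cell cZ.
have uq : cmpp i (emb D u) q by rewrite /cmpp q1.
have qv : cmpp i q (emb D v) by rewrite /cmpp q1.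
exists (compp i (emb D u) (compp i q (emb D v))).
  by exists u, v, q.
have Hi' := ltnW Hi.
apply: val_inj; rewrite val_compp //; last by rewrite cmppE (pbd_src Hi' qv).
by rewrite val_compp // q1 E.
Qed.

(* Here the atom may also have dimension <= n: the context is then an n-cell, which
   is interpreted by the given functor. *)
Definition ev_item i p := (deg n p.1 /\ p = emb D p.1) \/ Ev i p.

Definition Ev_functional i := forall p q, Ev i p -> Ev i q -> p.1 = q.1 -> p = q.

Lemma ev_item_over i p : i <= n -> ev_item i p -> lies_over p.
Proof. by move=> Hi [[dp ->]|/(Ev_over HD Hi)//]; apply: emb_over. Qed.

Lemma ev_item_total i u x : i <= n -> hdim u <= n.+1 -> is_item i u (val x) ->
  exists2 p : pair_cell D, ev_item i p & p.1 = x.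
Proof.
move=> Hi; rewrite leq_eqVlt => /predU1P[un|un] ix.
  have [|p Ep px] := @Ev_total i x (exist _ u _) Hi ix; first exact/eqP.
  by exists p; first right.
exists (emb D x) => //; left; split=> // j e nj.
by rewrite ix ?(leq_ltn_trans Hi) // atom_gt // (leq_ltn_trans _ nj).
Qed.

Lemma ev_item_fun i p q : i <= n -> Ev_functional i -> ev_item i p -> ev_item i q ->
  p.1 = q.1 -> p = q.
Proof.
move=> Hi F [[dp Ep]|Ep] [[dq Eq]|Eq] pq.
- by rewrite Ep Eq pq.
- by have := Ev_not_deg HD Hi Eq; rewrite -pq.
- by have := Ev_not_deg HD Hi Ep; rewrite pq.
- exact: F.
Qed.

Lemma ev_item_whisker_r i l p c : i <= n -> l < i -> ev_item i p -> deg i c ->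
  cmpp l p (emb D c) -> ev_item i (compp l p (emb D c)).
Proof.
move=> Hi li Ep dc pc; case: Ep => [[dp Ep]|Ep]; [left|right]; last exact: Ev_whisker_r.
have Hl := leq_trans (ltnW li) Hi; have dc' := deg_top Hi dc.
by split; [apply: deg_comp|rewrite Ep emb_comp].
Qed.

Lemma ev_item_whisker_l i l p c : i <= n -> l < i -> ev_item i p -> deg i c ->
  cmpp l (emb D c) p -> ev_item i (compp l (emb D c) p).
Proof.
move=> Hi li Ep dc pc; case: Ep => [[dp Ep]|Ep]; [left|right]; last exact: Ev_whisker_l.
have Hl := leq_trans (ltnW li) Hi; have dc' := deg_top Hi dc.
by split; [apply: deg_comp|rewrite Ep emb_comp].
Qed.

Lemma pitem_whisker_r i l u p c : i <= n -> l < i -> pitem i u p -> deg i c ->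
  cmpp l p (emb D c) -> pitem i u (compp l p (emb D c)).
Proof.
move=> Hi li ip dc pc j e ij; have Hl := leq_trans (ltnW li) Hi.
by rewrite val_compp // layers_comp_gt ?(ltn_trans li) // ip // dc // fsetU0.
Qed.

Lemma pitem_whisker_l i l u p c : i <= n -> l < i -> pitem i u p -> deg i c ->
  cmpp l (emb D c) p -> pitem i u (compp l (emb D c) p).
Proof.
move=> Hi li ip dc pc j e ij; have Hl := leq_trans (ltnW li) Hi.
by rewrite val_compp // layers_comp_gt ?(ltn_trans li) // ip // dc // fset0U.
Qed.

Section Interchange.
Variables (l : nat) (Hi : l < n) (p q : pair_cell D).
Let i := l.+1.
Hypotheses (pq : cmpp l p q) (op : lies_over p) (oq : lies_over q).
Let Hl : l <= n := ltnW Hi.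
Let sp := bd_id_cell Neg i p.1.
Let tp := bd_id_cell Pos i p.1.
Let sq := bd_id_cell Neg i q.1.
Let tq := bd_id_cell Pos i q.1.

Let o_bd e (r : pair_cell D) : lies_over (emb D (bd_id_cell e i r.1)).
Proof. by apply: emb_over => //; apply: deg_top Hi _; apply: deg_bd_id_cell. Qed.

Let p_bd e : cmpp l p (emb D (bd_id_cell e i q.1)).
Proof. by rewrite cmppE pbd_id_lt. Qed.

Let bd_q e : cmpp l (emb D (bd_id_cell e i p.1)) q.
Proof. by rewrite cmppE pbd_id_lt. Qed.

Let ptp : cmpp i p (emb D tp). Proof. by rewrite cmppE pbd_id_eq. Qed.
Let qtq : cmpp i q (emb D tq). Proof. by rewrite cmppE pbd_id_eq. Qed.
Let spp : cmpp i (emb D sp) p. Proof. by rewrite cmppE pbd_id_eq. Qed.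
Let sqq : cmpp i (emb D sq) q. Proof. by rewrite cmppE pbd_id_eq. Qed.

(** Exchange applied to p = p *_i tp and q = sq *_i q. With its mirror image [interchange_qp], it
    shows that both orders of performing [p] and [q] in dimension i have the same value p *_l q. *)
Lemma interchange_pq :
  compp i (compp l p (emb D sq)) (compp l (emb D tp) q) = compp l p q.
Proof.
rewrite -(compp_exchange HD (ltnSn l) Hi) //; try exact: o_bd; try exact: p_bd.
by rewrite -pair_id_r // -pair_id_l.
Qed.

Lemma interchange_qp :
  compp i (compp l (emb D sp) q) (compp l p (emb D tq)) = compp l p q.
Proof.
rewrite -(compp_exchange HD (ltnSn l) Hi) //; try exact: o_bd; try exact: bd_q.
by rewrite -pair_id_r // -pair_id_l.
Qed.

Lemma interchange_cmp_pq : cmpp i (compp l p (emb D sq)) (compp l (emb D tp) q).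
Proof.
by rewrite cmppE !pbd_gt // ?pbd_id_eq //; [apply: bd_q|apply: p_bd].
Qed.

Lemma interchange_cmp_qp : cmpp i (compp l (emb D sp) q) (compp l p (emb D tq)).
Proof.
by rewrite cmppE !pbd_gt // ?pbd_id_eq //; [apply: p_bd|apply: bd_q].
Qed.

End Interchange.

(** An initial part of [T]: whatever precedes one of its elements is itself neither in [S] nor above
    it. The cut of [T] into this set and its complement thus exists for every [S], without a segment
    condition. *)
Definition not_above T S : {fset P} :=
  [fset a in T | (a \notin S) && ~~ `[< exists2 s, s \in S & tri (mem T) s a >]].

Lemma not_above_split T S : let I := not_above T S in let K := T `\` I in
  [/\ I `&` K = fset0, I `|` K = T & hbdU Neg I `&` hbdU Pos K = fset0].
Proof.
move=> I K; have IT : I `<=` T by apply/fsubsetP => a; rewrite !inE /= => /and3P[].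
split; rewrite /K; [by fset_solve|by fset_solve|].
apply/fsetP => z; rewrite in_fsetI in_fset0; apply/negP.
move=> /andP[/hbdUP[a aI za] /hbdUP[b bK zb]].
have aT : a \in T by apply: fsubsetP aI.
have [bI bT] : b \notin I /\ b \in T by move: bK; rewrite in_fsetD => /andP[].
have ba : tri (mem T) b a.
  by apply: t_step; split=> //; apply/fset0Pn; exists z; apply/fsetIP.
move: aI; rewrite !inE /= => /and3P[_ aS /asboolP na].
move: bI; rewrite !inE /= bT /= negb_and !negbK => /orP[bS|/asboolP[s sS sb]].
  by apply: na; exists b.
by apply: na; exists s => //; apply: t_trans sb ba.
Qed.

Lemma sub_not_above T S R : R `<=` T -> R `&` S = fset0 ->
  ~ tri_sets (mem T) S R -> R `<=` not_above T S.
Proof.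
move=> RT /fsetP RS nt; apply/fsubsetP => a aR; rewrite !inE /=.
rewrite (fsubsetP RT) //=; apply/andP; split.
  by have := RS a; rewrite in_fsetI aR /= in_fset0 => ->.
by apply/asboolP => -[s sS sa]; apply: nt; exists s, a.
Qed.

Lemma sub_above T S : S `<=` T -> S `<=` T `\` not_above T S.
Proof.
move=> ST; apply/fsubsetP => a aS; rewrite !inE /=.
by rewrite aS /= (fsubsetP ST) // andbF.
Qed.

(** Produces, with a value, the item around [u] whose i-boundary of sign [e] is prescribed; the
    opposite boundary is then forced. *)
Lemma item_over i u (A : layers P) e : i <= n -> i < hdim u -> hdim u <= n.+1 ->
  is_cell n.+1 A -> degenerate i A -> atom u i e `<=` A i e ->
  exists p, [/\ ev_item i p, pitem i u p & pbd e i p = A].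
Proof.
move=> Hi iu un cA dA sA.
have [X [cX iX bX]] := item_exists tf iu (cell_layer e cA (leqW Hi)) sA.
have [p Ep pX] := @ev_item_total i u (mk_cell (cell_leq un cX)) Hi un iX.
exists p; rewrite /pitem /pbd pX; split=> //=.
rewrite bX; apply: layersP => j e'; case: (ltngtP j i) => [ji|ji|->].
- by rewrite with_top_lt.
- by rewrite with_top_gt // dA.
- rewrite with_topE; case: e e' {sA bX} => [] [] //.
    exact: (degenerate_sign cA dA (leqW Hi)).
  exact/esym/(degenerate_sign cA dA (leqW Hi)).
Qed.

Lemma pbd_pbd e e' l p : pbd e l p = layers_bd e l (pbd e' l.+1 p).
Proof. by rewrite /pbd layers_bd_bd. Qed.

(* Torsion-freeness yields a composite I *_l K, equal to the i-cell between p and q, one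
   factor of which contains <u>_{i,+} and the other <v>_{i,-}.  Hence p and q are
   whiskerings of items living on different factors, and the exchange law applies. *)
Lemma swap i u v p q : i <= n -> Ev_functional i ->
  i < hdim u <= n.+1 -> i < hdim v <= n.+1 ->
  ev_item i p -> ev_item i q -> pitem i u p -> pitem i v q -> cmpp i p q ->
  atom u i Pos `&` atom v i Neg = fset0 ->
  exists p' q', [/\ ev_item i p' /\ ev_item i q', pitem i u p', pitem i v q',
    cmpp i q' p' & compp i p q = compp i q' p'].
Proof.
move=> Hi F /andP[iu un] /andP[iv vn] Ep Eq ip iq pq duv.
have su : atom u i Pos `<=` val p.1 i Pos := item_atom_sub tf Pos (Hi : i < n.+1) iu (cellP p.1) ip.
have sv : atom v i Neg `<=` val p.1 i Pos.
  by rewrite (cmp_eq pq); apply: item_atom_sub iv (cellP q.1) iq => //; apply: (Hi : i < n.+1).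
(* In dimension 0 both inclusions are equalities of singletons, against disjointness; hence there is
   a dimension [l] below to exchange along. *)
case: i Hi F iu iv Ep Eq ip iq pq duv su sv => [|l] Hi F iu iv Ep Eq ip iq pq duv su sv.
  have [_ _ /(_ 0 Pos (leq0n _)) /= c1] := cellP p.1.
  have /= cu := atom_fork_free tf Pos (leq0n (hdim u)).
  have /= cv := atom_fork_free tf Neg (leq0n (hdim v)).
  have Eu : atom u 0 Pos = val p.1 0 Pos by apply/eqP; rewrite eqEfcard su cu c1.
  have Ev : atom v 0 Neg = val p.1 0 Pos by apply/eqP; rewrite eqEfcard sv cv c1.
  by rewrite Eu Ev fsetIid in duv; rewrite duv cardfs0 in c1.
set T := val p.1 l.+1 Pos in su sv.
have Hl := ltnW Hi.
have cA1 := is_cell_bd Pos (Hi : l.+1 < n.+1) (cellP p.1).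
have cA : is_cell n.+1 (pbd Pos l.+1 p) := cell_leq (leqW Hi) cA1.
have dA : degenerate l.+1 (pbd Pos l.+1 p) by apply: degenerate_bd.
have AT e : pbd Pos l.+1 p l.+1 e = T by rewrite /pbd layers_bd_eq.
have topA : top (mk_cell cA1) = T by rewrite /top /= layers_bd_eq.
have split_at R : let I := not_above T R in let K := T `\` I in
  exists Y Z, [/\ is_cell n.+1 Y /\ is_cell n.+1 Z,
    degenerate l.+1 Y /\ degenerate l.+1 Z,
    (forall e, Y l.+1 e = I) /\ (forall e, Z l.+1 e = K),
    layers_cmp l Y Z & pbd Pos l.+1 p = layers_comp l Y Z].
  move=> I K; have [d1 d2 d3] := not_above_split T R.
  apply: (cell_split tf (Hl : l < n.+1) cA dA) => //.
  by rewrite AT.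
(* If <v> precedes <u> in [T], torsion-freeness forbids the converse, and the elements not above <u>
   contain the source of <v>. Otherwise the elements not above <v> contain the target of <u>. In
   each case the cut separates the two atoms. *)
have [bad|ok] := pselect (tri_sets (mem T) (atom v l.+1 Neg) (atom u l.+1 Pos)).
  have ok : ~ tri_sets (mem T) (atom u l.+1 Pos) (atom v l.+1 Neg).
    move=> bad'; apply: (tf_torsion tf); exists l.+1, u, v, (mk_cell cA1).
    by rewrite topA leq_min iu iv.
  have [Y [Z [[cY cZ] [dY dZ] [YI ZK] YZ AE]]] := split_at (atom u l.+1 Pos).
  have [|y [Ey iy sy]] := item_over (e := Neg) Hi iv vn cY dY.
    by rewrite YI; apply: sub_not_above => //; rewrite fsetIC.
  have [|x [Ex ix tx]] := item_over (e := Pos) Hi iu un cZ dZ.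
    by rewrite ZK; apply: sub_above.
  have yx : cmpp l y x.
    by rewrite cmppE (pbd_pbd Pos Neg) sy (pbd_pbd Neg Pos) tx.
  have [oy ox] := (ev_item_over Hi Ey, ev_item_over Hi Ex).
  have dd e (r : pair_cell D) : deg l.+1 (bd_id_cell e l.+1 r.1) by apply: deg_bd_id_cell.
  have yd e : cmpp l y (emb D (bd_id_cell e l.+1 x.1)) by rewrite cmppE pbd_id_lt.
  have dx e : cmpp l (emb D (bd_id_cell e l.+1 y.1)) x by rewrite cmppE pbd_id_lt.
  have E1 e := ev_item_whisker_l Hi (ltnSn l) Ex (dd e y) (dx e).
  have E2 e := ev_item_whisker_r Hi (ltnSn l) Ey (dd e x) (yd e).
  have i1 e := pitem_whisker_l Hi (ltnSn l) ix (dd e y) (dx e).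
  have i2 e := pitem_whisker_r Hi (ltnSn l) iy (dd e x) (yd e).
  (* Both sides are items around [u] with the same i-target, so their cells agree by [pitem_det] and
     their values by functionality in dimension i. *)
  have pE : p = compp l (emb D (bd_id_cell Neg l.+1 y.1)) x.
    apply: (ev_item_fun Hi F Ep (E1 Neg)); apply: (pitem_det Hi ip (i1 Neg) (e := Pos)).
    by rewrite AE pbd_gt // pbd_id_eq // tx [pbd _ _ (emb _ _)]sy.
  have qE : q = compp l y (emb D (bd_id_cell Pos l.+1 x.1)).
    apply: (ev_item_fun Hi F Eq (E2 Pos)); apply: (pitem_det Hi iq (i2 Pos) (e := Neg)).
    by rewrite -[LHS]pq [LHS]AE pbd_gt // pbd_id_eq // sy [pbd _ _ (emb _ _)]tx.
  exists (compp l (emb D (bd_id_cell Pos l.+1 y.1)) x),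
    (compp l y (emb D (bd_id_cell Neg l.+1 x.1))); split=> //.
    exact: interchange_cmp_pq.
  by rewrite pE qE interchange_qp // interchange_pq.
have [Y [Z [[cY cZ] [dY dZ] [YI ZK] YZ AE]]] := split_at (atom v l.+1 Neg).
have [|x [Ex ix tx]] := item_over (e := Pos) Hi iu un cY dY.
  by rewrite YI; apply: sub_not_above.
have [|y [Ey iy sy]] := item_over (e := Neg) Hi iv vn cZ dZ.
  by rewrite ZK; apply: sub_above.
have xy : cmpp l x y.
  by rewrite cmppE (pbd_pbd Pos Pos) tx (pbd_pbd Neg Neg) sy.
have [ox oy] := (ev_item_over Hi Ex, ev_item_over Hi Ey).
have dd e (r : pair_cell D) : deg l.+1 (bd_id_cell e l.+1 r.1) by apply: deg_bd_id_cell.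
have xd e : cmpp l x (emb D (bd_id_cell e l.+1 y.1)) by rewrite cmppE pbd_id_lt.
have dy e : cmpp l (emb D (bd_id_cell e l.+1 x.1)) y by rewrite cmppE pbd_id_lt.
have E1 e := ev_item_whisker_l Hi (ltnSn l) Ey (dd e x) (dy e).
have E2 e := ev_item_whisker_r Hi (ltnSn l) Ex (dd e y) (xd e).
have i1 e := pitem_whisker_l Hi (ltnSn l) iy (dd e x) (dy e).
have i2 e := pitem_whisker_r Hi (ltnSn l) ix (dd e y) (xd e).
have pE : p = compp l x (emb D (bd_id_cell Neg l.+1 y.1)).
  apply: (ev_item_fun Hi F Ep (E2 Neg)); apply: (pitem_det Hi ip (i2 Neg) (e := Pos)).
  by rewrite AE pbd_gt // pbd_id_eq // tx [pbd _ _ (emb _ _)]sy.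
have qE : q = compp l (emb D (bd_id_cell Pos l.+1 x.1)) y.
  apply: (ev_item_fun Hi F Eq (E1 Pos)); apply: (pitem_det Hi iq (i1 Pos) (e := Neg)).
  by rewrite -[LHS]pq [LHS]AE pbd_gt // pbd_id_eq // sy [pbd _ _ (emb _ _)]tx.
exists (compp l x (emb D (bd_id_cell Pos l.+1 y.1))),
  (compp l (emb D (bd_id_cell Neg l.+1 x.1)) y); split=> //.
  exact: interchange_cmp_qp.
by rewrite pE qE interchange_qp // interchange_pq.
Qed.

End Swap.

(** * Uniqueness of the value of an item *)

Section Functionality.
Variables (P : hypergraph) (tf : torsion_free P) (n : nat).
Variable D : cocone (CellExt tf n).
Hypothesis HD : is_cocone D.
Let C := CellCat P.
Implicit Types (p q r : pair_cell D) (x y : cell P n.+1) (e : sign) (i j l : nat).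
Implicit Types (S T : {fset P}) (w : P) (X Y Z : layers P).

Lemma atom_gen (g : gens P n.+1) e : atom (val g) n.+1 e = [fset val g].
Proof. by move: (val g) (eqP (valP g)) => u <-; rewrite atom_top. Qed.

Lemma card_diff_fsetD1 S T w : w \in S `\` T ->
  #|` (S `\ w) `\` T| + #|` T `\` (S `\ w)| < #|` S `\` T| + #|` T `\` S|.
Proof.
move=> wST; have -> : (S `\ w) `\` T = (S `\` T) `\ w.
  by apply/fsetP => z; rewrite !inE; case: (z == w); rewrite ?andbF.
have -> : T `\` (S `\ w) = T `\` S.
  apply/fsetP => z; rewrite !inE; case: (z =P w) => //= ->.
  by move: wST; rewrite in_fsetD => /andP[/negPf-> _]; rewrite andbF.
by rewrite (cardfsD1 w (S `\` T)) wST.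
Qed.

Lemma cmpp_disj i p q j e : i <= n -> cmpp i p q -> i < j ->
  val p.1 j e `&` val q.1 j e = fset0.
Proof.
move=> Hi c ij.
by have [_ d _] := comp_cell tf (Hi : i < n.+1) (cellP p.1) (cellP q.1) c; apply: d.
Qed.

Lemma cmpp_arrow i p q e (a b : P) : i <= n -> cmpp i p q ->
  a \in val p.1 i.+1 e -> b \in val q.1 i.+1 e -> ~~ arrow b a.
Proof.
move=> Hi c ap bq; apply/negP => /arrowP[z zb za].
have [_ _ d] := comp_cell tf (Hi : i < n.+1) (cellP p.1) (cellP q.1) c.
have /fsetP/(_ z) := d e; rewrite in_fsetI in_fset0 => /negP[].
by apply/andP; split; apply/hbdUP; [exists a|exists b].
Qed.

Lemma cmpp_cancel i p q q' : i <= n -> cmpp i p q -> cmpp i p q' ->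
  (compp i p q).1 = (compp i p q').1 -> q.1 = q'.1.
Proof.
move=> Hi c c' E; apply: val_inj.
apply: (comp_cancell tf (Hi : i < n.+1) (cellP p.1) (cellP q.1) (cellP q'.1) c c').
by have := congr1 val E; rewrite !val_compp.
Qed.

(** One unfolding of [Ev i.+1] with its witnesses named, so that two presentations of the same item
    can be compared. *)
Definition decomp i u v q :=
  [/\ deg i.+1 u /\ deg i.+1 v, Ev i q, cmpp i (emb D u) q & cmpp i q (emb D v)].

Definition decomp_val i u v q := compp i (emb D u) (compp i q (emb D v)).

Lemma decomp_cmp i u v q : i <= n -> decomp i u v q ->
  cmpp i (emb D u) (compp i q (emb D v)).
Proof. by move=> Hi [_ _ uq qv]; rewrite cmppE (pbd_src Hi qv). Qed.

Lemma decomp_layer i u v q j e : i <= n -> decomp i u v q -> i < j ->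
  val (decomp_val i u v q).1 j e = val u j e `|` (val q.1 j e `|` val v j e).
Proof.
move=> Hi d ij; have c := decomp_cmp Hi d; have [_ _ uq qv] := d.
by rewrite val_compp // layers_comp_gt // val_compp // layers_comp_gt.
Qed.

(* A maximal element w of u that is not below the item q is moved from u to v. *)
Lemma decomp_move i u v q w : i < n -> Ev_functional D i -> decomp i u v q ->
  w \in val u i.+1 Neg -> (forall s, s \in val u i.+1 Neg -> ~~ arrow w s) ->
  (forall s, s \in val q.1 i.+1 Neg -> ~~ arrow w s) ->
  exists u' v' q', [/\ decomp i u' v' q', val u' i.+1 Neg = val u i.+1 Neg `\ w
    & decomp_val i u' v' q' = decomp_val i u v q].
Proof.
move=> Hi F [[du dv] Eq uq qv] wu wmax wq; have Hi' := ltnW Hi.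
have hw := cell_hdim (cellP u) wu.
have i12 : hbdU Neg (val u i.+1 Neg `\ w) `&` hbdU Pos [fset w] = fset0.
  apply/fsetP => z; rewrite hbdU1 in_fsetI in_fset0; apply/negP.
  move=> /andP[/hbdUP[s /fsetD1P[_ su] zs] zw].
  by have /negP[] := wmax s su; apply/arrowP; exists z.
have d12 : (val u i.+1 Neg `\ w) `&` [fset w] = fset0.
  by apply/fsetP => z; rewrite !inE; case: eqP => //= _; rewrite andbF.
have e12 : (val u i.+1 Neg `\ w) `|` [fset w] = val u i.+1 Neg.
  by rewrite fsetUC fsetD1K.
have [Y [Z [[cY cZ] [dY dZ] [YS Zw] YZ uE]]] :=
  cell_split tf (Hi' : i < n.+1) (cellP u) du d12 e12 i12.
pose u0 := mk_cell cY; pose wA := mk_cell cZ.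
have du0 : deg n u0 := degenerateW Hi dY; have dwA : deg n wA := degenerateW Hi dZ.
have c0 : cmpp i (emb D u0) (emb D wA) := YZ.
have Eu : emb D u = compp i (emb D u0) (emb D wA).
  rewrite -(emb_comp HD) //; congr emb; apply: val_inj.
  by rewrite (val_ccomp tf (Hi' : i < n.+1)).
(* As [w] has dimension i+1, the split-off factor [wA] is itself an item around the atom of [w], so
   [swap] applies to it and [q]. *)
have iw : pitem i w (emb D wA).
  move=> j e; rewrite leq_eqVlt => /predU1P[<-|ij] /=.
    by rewrite Zw -hw atom_top.
  by rewrite dZ // atom_gt // hw.
have [oq [g ig]] := Ev_spec HD Hi' Eq.
have gn : hdim (val g) = n.+1 by apply/eqP/(valP g).
have dwg : atom w i Pos `&` atom (val g) i Neg = fset0.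
  rewrite (atom_hbd tf) // (atom_step (n := i)) ?gn // -ig //=.
  apply/fsetP => z; rewrite in_fsetI in_fsetD in_fset0; apply/negP.
  move=> /and3P[zw _ /hbdUP[s sq zs]].
  by have /negP[] := wq s sq; apply/arrowP; exists z.
have c1 : cmpp i (emb D wA) q by move: uq; rewrite Eu cmppE (pbd_tgt Hi' c0).
have [||||p' [q' [[Ep' Eq'] ip' iq' c2 E]]] :=
  swap HD Hi' F _ _ _ _ iw ig c1 dwg.
- by rewrite hw ltnSn ltnW.
- by rewrite gn leqnn andbT; apply: ltnW.
- by left.
- by right.
have dp' : deg i.+1 p'.1.
  by move=> j e ij; rewrite ip' ?(ltnW ij) // atom_gt // hw.
have {}Ep' : p' = emb D p'.1.
  by case: Ep' => [[]//|/(Ev_not_deg HD Hi')[]]; apply: deg_top dp'.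
(* The exchanged item keeps the layers of <g> above i, so it cannot be the degenerate alternative of
   [ev_item]. *)
have {}Eq' : Ev i q'.
  case: Eq' => [[dq' _]|//]; have [] := Ev_not_deg HD Hi' Eq.
  move=> j e nj; rewrite ig ?(leq_ltn_trans Hi') // -iq' ?(leq_ltn_trans Hi') //.
  exact: dq'.
have dv' := deg_top Hi dv; have dp'' := deg_top Hi dp'.
have op' : lies_over p' by rewrite Ep'; apply: emb_over.
have oq' := Ev_over HD Hi' Eq'.
have ov := emb_over HD dv'; have ou0 := emb_over HD du0; have owA := emb_over HD dwA.
have c3 : cmpp i p' (emb D v).
  by rewrite cmppE -(pbd_tgt Hi' c2) -E (pbd_tgt Hi' c1).
have c3' : cmpp i (emb D p'.1) (emb D v) by rewrite -Ep'.
have Ev' : emb D (ccomp i (p'.1 : C n.+1) v) = compp i p' (emb D v).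
  by rewrite (emb_comp HD Hi' dp'' dv' c3') -Ep'.
have c4 : cmpp i (emb D u0) q'.
  by rewrite cmppE -(pbd_src Hi' c2) -E (pbd_src Hi' c1).
have c5 : cmpp i q' (compp i p' (emb D v)) by rewrite cmppE (pbd_src Hi' c3).
have c6 : cmpp i (emb D wA) (compp i q (emb D v)) by rewrite cmppE (pbd_src Hi' qv).
have oqv := over_comp HD Hi' oq ov qv.
exists u0, (ccomp i (p'.1 : C n.+1) v), q'; split.
- by split; [split=> //; apply: deg_comp| | |rewrite Ev'].
- by rewrite /= YS.
- rewrite /decomp_val Ev' Eu (comppA HD (p := emb D u0)) //.
  by rewrite -(comppA HD Hi' oq' op' ov c2 c3) -E (comppA HD Hi' owA oq ov).
Qed.

(** A maximal [w] in the difference can be moved past the item, as the second decomposition shows: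
    there [w] lies in [v2], so it precedes nothing in [u2] or in [q2], and [q2] has the same layers
    as [q1] above i. *)
Lemma decomp_diff i u1 v1 q1 u2 v2 q2 : i < n -> Ev_functional D i ->
  decomp i u1 v1 q1 -> decomp i u2 v2 q2 ->
  (decomp_val i u1 v1 q1).1 = (decomp_val i u2 v2 q2).1 ->
  val u1 i.+1 Neg `\` val u2 i.+1 Neg != fset0 ->
  exists w u' v' q', [/\ w \in val u1 i.+1 Neg `\` val u2 i.+1 Neg, decomp i u' v' q',
    val u' i.+1 Neg = val u1 i.+1 Neg `\ w & decomp_val i u' v' q' = decomp_val i u1 v1 q1].
Proof.
move=> Hi F d1 d2 E ne; have Hi' := ltnW Hi.
have [w wd wmax] := exists_maximal tf ne.
have L1 j e := decomp_layer e Hi' d1 (j := j); have L2 j e := decomp_layer e Hi' d2 (j := j).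
have [[du1 dv1] Eq1 uq1 qv1] := d1; have [[du2 dv2] Eq2 uq2 qv2] := d2.
have [_ [g1 i1]] := Ev_spec HD Hi' Eq1; have [_ [g2 i2]] := Ev_spec HD Hi' Eq2.
have [w1 w2] : w \in val u1 i.+1 Neg /\ w \notin val u2 i.+1 Neg.
  by move: wd; rewrite in_fsetD => /andP[].
have qq j e : i < j -> val q1.1 j e = val q2.1 j e.
  have := L1 n.+1 Neg; rewrite E L2 ?du1 ?du2 ?dv1 ?dv2 //.
  rewrite !fset0U !fsetU0 => /(_ Hi'); rewrite i1 // i2 //.
  rewrite !atom_gen => /fset1_inj/val_inj g12 ij; by rewrite i1 // i2 // g12.
have wx : w \in val q2.1 i.+1 Neg `|` val v2 i.+1 Neg.
  have : w \in val (decomp_val i u1 v1 q1).1 i.+1 Neg.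
    by rewrite L1 // in_fsetU w1.
  by rewrite E L2 // in_fsetU (negPf w2).
have wq : w \notin val q2.1 i.+1 Neg.
  rewrite -qq //; apply/negP => wq1.
  by have /fsetP/(_ w) := cmpp_disj Neg Hi' uq1 (ltnSn i); rewrite in_fsetI w1 wq1.
have wv : w \in val v2 i.+1 Neg by move: wx; rewrite in_fsetU (negPf wq).
have [||u' [v' [q' [d' Su' E']]]] := decomp_move Hi F d1 w1.
- move=> s s1; have [s2|s2] := boolP (s \in val u2 i.+1 Neg); last first.
    by apply: wmax; rewrite in_fsetD s2.
  apply: (cmpp_arrow Hi' (decomp_cmp Hi' d2) (e := Neg)) => //.
  by rewrite val_compp // layers_comp_gt.
- by move=> s; rewrite qq // => s2; apply: (cmpp_arrow Hi' qv2 (e := Neg)).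
by exists w, u', v', q'.
Qed.

Lemma Ev_functional_all i : i <= n -> Ev_functional D i.
Proof.
elim: i => [|i IH] Hi.
  move=> p q [g ->] [h ->] /= /(congr1 val)/(congr1 (fun X : layers P => X n.+1 Neg)) /=.
  by rewrite !atom_gen => /fset1_inj/val_inj ->.
have Hi' := ltnW Hi; have F := IH Hi'.
(* Induction on the size of the symmetric difference of the left parts; each application of
   [decomp_diff] removes one element from it. *)
suff H k : forall u1 v1 q1 u2 v2 q2,
    #|` val u1 i.+1 Neg `\` val u2 i.+1 Neg| + #|` val u2 i.+1 Neg `\` val u1 i.+1 Neg| < k ->
    decomp i u1 v1 q1 -> decomp i u2 v2 q2 ->
    (decomp_val i u1 v1 q1).1 = (decomp_val i u2 v2 q2).1 ->
    decomp_val i u1 v1 q1 = decomp_val i u2 v2 q2.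
  move=> p q [u1 [v1 [q1 [d1 e1 f1 g1 ->]]]] [u2 [v2 [q2 [d2 e2 f2 g2 ->]]]].
  by apply: H (leqnn _) _ _; split.
elim: k => // k IHk u1 v1 q1 u2 v2 q2; rewrite ltnS => lek d1 d2 E.
have [s12|n12] := eqVneq (val u1 i.+1 Neg `\` val u2 i.+1 Neg) fset0; last first.
  have [w [u' [v' [q' [wd d' Su' E']]]]] := decomp_diff Hi F d1 d2 E n12.
  rewrite -E'; apply: IHk => //; last by rewrite E'.
  by apply: leq_trans lek; rewrite Su'; apply: card_diff_fsetD1.
have [s21|n21] := eqVneq (val u2 i.+1 Neg `\` val u1 i.+1 Neg) fset0; last first.
  have [w [u' [v' [q' [wd d' Su' E']]]]] := decomp_diff Hi F d2 d1 (esym E) n21.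
  rewrite -E'; apply: IHk => //; last by rewrite E'.
  by apply: leq_trans lek; rewrite Su' addnC [X in _ < X]addnC; apply: card_diff_fsetD1.
have S12 : val u1 i.+1 Neg = val u2 i.+1 Neg.
  by apply/eqP; rewrite eqEfsubset -!fsetD_eq0 s12 s21 eqxx.
have [[du1 dv1] Eq1 uq1 qv1] := d1; have [[du2 dv2] Eq2 uq2 qv2] := d2.
have c1 := decomp_cmp Hi' d1; have c2 := decomp_cmp Hi' d2.
(* Both are degenerate above i+1, have the same layer there, and share the i-source of the common
   composite. The remaining factors are then identified by cancellation and induction. *)
have Eu : u1 = u2.
  apply: val_inj; apply: (cell_det (e := Neg) (cellP u1) (cellP u2) (Hi' : i < n.+1)).
    move=> j e; rewrite leq_eqVlt => /predU1P[<-|ij]; last by rewrite du1 // du2.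
    case: e => //.
    by rewrite -(degenerate_sign (cellP u1) du1) // -(degenerate_sign (cellP u2) du2).
  by have := congr1 (fun x : cell P n.+1 => layers_bd Neg i (val x)) E;
    rewrite [LHS](pbd_src Hi' c1) [RHS](pbd_src Hi' c2).
subst u2.
have Eqv := cmpp_cancel Hi' c1 c2 E.
have [_ [g1 i1]] := Ev_spec HD Hi' Eq1; have [_ [g2 i2]] := Ev_spec HD Hi' Eq2.
have g12 : g1 = g2.
  have := congr1 (fun x : cell P n.+1 => val x n.+1 Neg) Eqv.
  rewrite !val_compp // !layers_comp_gt // dv1 // dv2 // i1 // i2 // !fsetU0.
  by rewrite !atom_gen => /fset1_inj/val_inj.
subst g2.
have Eq : q1 = q2.
  apply: F => //; apply: (pitem_det Hi' i1 i2 (e := Neg)).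
  by rewrite -[LHS]uq1 [LHS]uq2.
subst q2.
by have /= -> := cmpp_cancel Hi' qv1 qv2 Eqv.
Qed.

End Functionality.

(** * Values of (n+1)-cells *)

Section TopEvaluation.
Variables (P : hypergraph) (tf : torsion_free P) (n : nat).
Variable D : cocone (CellExt tf n).
Hypothesis HD : is_cocone D.
Let C := CellCat P.
Implicit Types (p q r : pair_cell D) (x y z : cell P n.+1) (e : sign) (i j l : nat).
Implicit Types (S T : {fset P}) (X Y Z : layers P).

(** Lists of items composed along n and closed by an identity. Each item contributes exactly one
    element to the top layer, whose size is thus the length of the list. *)
Inductive EvT : pair_cell D -> Prop :=
| EvT_id x : deg n x -> EvT (emb D x)
| EvT_step q p : Ev n q -> EvT p -> cmpp n q p -> EvT (compp n q p).

Lemma EvT_over p : EvT p -> lies_over p.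
Proof.
elim=> {p} [x dx|q p Eq _ op c]; first exact: emb_over.
by apply: over_comp => //; apply: Ev_over Eq.
Qed.

Notation ntop x := (val x n.+1 Neg).

Lemma deg_ntop x : deg n x <-> ntop x = fset0.
Proof.
split=> [dx|x0 j e]; first exact: dx.
rewrite leq_eqVlt => /predU1P[<-|nj]; last exact: cell_degenerate (cellP x) _ _ nj.
by case: e => //; rewrite -(degenerate_sign (cellP x) (cell_degenerate (cellP x))).
Qed.

Lemma peel x (h : P) : h \in ntop x -> (forall k, k \in ntop x -> ~~ arrow k h) ->
  exists y z, [/\ is_item n h (val y), cmp n y z, ntop z = ntop x `\ h
    & x = ccomp n (y : C n.+1) z].
Proof.
move=> hx hmin; have hh := cell_hdim (cellP x) hx.
have d12 : [fset h] `&` (ntop x `\ h) = fset0.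
  by apply/fsetP => z; rewrite !inE; case: eqP.
have i12 : hbdU Neg [fset h] `&` hbdU Pos (ntop x `\ h) = fset0.
  apply/fsetP => z; rewrite hbdU1 in_fsetI in_fset0; apply/negP.
  move=> /andP[zh /hbdUP[k /fsetD1P[_ kx] zk]].
  by have /negP[] := hmin k kx; apply/arrowP; exists z.
have [Y [Z [[cY cZ] [dY dZ] [Yh Zh] YZ xE]]] :=
  cell_split tf (ltnSn n) (cellP x) (cell_degenerate (cellP x)) d12 (fsetD1K hx) i12.
exists (mk_cell cY), (mk_cell cZ); split=> //.
- move=> j e; rewrite leq_eqVlt => /predU1P[<-|nj] /=.
    by rewrite Yh -hh atom_top.
  by rewrite dY // atom_gt // hh.
- by apply: val_inj; rewrite (val_ccomp tf (ltnSn n)).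
Qed.

Lemma item_ntop p (g : gens P n.+1) : is_item n (val g) (val p.1) -> ntop p.1 = [fset val g].
Proof. by move=> ip; rewrite ip // atom_gen. Qed.

Lemma Ev_item_total x (h : P) : h \in ntop x -> is_item n h (val x) ->
  exists2 p : pair_cell D, Ev n p & p.1 = x.
Proof.
move=> hx ix; have hh : hdim h == n.+1 by apply/eqP/(cell_hdim (cellP x) hx).
exact: (@Ev_total _ tf n D n x (exist _ h hh)).
Qed.

Lemma EvT_total x : exists2 p, EvT p & p.1 = x.
Proof.
have [k] := ubnP #|` ntop x|; elim: k x => // k IH x; rewrite ltnS => xk.
have [x0|/(exists_minimal tf)[h hx hmin]] := eqVneq (ntop x) fset0.
  by exists (emb D x) => //; apply: EvT_id; apply/deg_ntop.
have [y [z [iy yz zE xE]]] := peel hx hmin.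
have hh := cell_hdim (cellP x) hx.
have [|q Eq qy] := @Ev_item_total y h _ iy; first by rewrite iy // -hh atom_top inE.
have [|p Ep pz] := IH z; first by rewrite zE; move: xk; rewrite (cardfsD1 h) hx.
have c : cmpp n q p by rewrite /cmpp qy pz.
exists (compp n q p); first exact: EvT_step.
by rewrite /= qy pz xE.
Qed.

Lemma compp_ntop q p : cmpp n q p -> ntop (compp n q p).1 = ntop q.1 `|` ntop p.1.
Proof. by move=> c; rewrite val_compp // layers_comp_gt. Qed.

(* Two sequences of items with the same composite start with items g and h; both
   are minimal, so h can be moved to the front of the first sequence. *)
Lemma EvT_fun p q : EvT p -> EvT q -> p.1 = q.1 -> p = q.
Proof.
have [k] := ubnP #|` ntop p.1|; elim: k p q => // k IH p q; rewrite ltnS => pk.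
have F : Ev_functional D n by apply: Ev_functional_all.
have nE q0 p0 : Ev n q0 -> cmpp n q0 p0 ->
    exists h : gens P n.+1, [/\ is_item n (val h) (val q0.1), ntop q0.1 = [fset val h],
      val h \notin ntop p0.1
      & #|` ntop (compp n q0 p0).1| = #|` ntop p0.1|.+1].
  move=> E0 c0; have [_ [h ih]] := Ev_spec HD (leqnn n) E0; exists h.
  have h0 : val h \notin ntop p0.1.
    apply/negP => hp0; have /fsetP/(_ (val h)) := cmpp_disj Neg (leqnn n) c0 (ltnSn n).
    by rewrite in_fsetI (item_ntop ih) hp0 inE eqxx.
  by split=> //; [apply: item_ntop|rewrite compp_ntop // (item_ntop ih) cardfsU1 h0].
move=> Hp Hq; case: Hp pk Hq => {p} [x dx|q1 p1 E1 T1 c1] pk [y dy|q2 p2 E2 T2 c2] pq.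
- by move: pq => /= ->.
- have [h [_ _ _ hc]] := nE _ _ E2 c2; have /deg_ntop x0 : deg n (compp n q2 p2).1 by rewrite -pq.
  by rewrite x0 cardfs0 in hc.
- have [h [_ _ _ hc]] := nE _ _ E1 c1; have /deg_ntop x0 : deg n (compp n q1 p1).1 by rewrite pq.
  by rewrite x0 cardfs0 in hc.
have [g [ig gt gp gc]] := nE _ _ E1 c1; have [h [ih ht hp hc]] := nE _ _ E2 c2.
have pq' := pq.
have lt1 : #|` ntop p1.1| < k by rewrite -gc.
have src : pbd Neg n q1 = pbd Neg n q2.
  by rewrite -(pbd_src (leqnn n) c1) -(pbd_src (leqnn n) c2) /pbd pq'.
have topE : ntop q1.1 `|` ntop p1.1 = ntop q2.1 `|` ntop p2.1.
  by rewrite -!compp_ntop // pq'.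
have [gh|gh] := eqVneq (val g) (val h).
  have q12 : q1 = q2.
    apply: F => //; rewrite gh in ig; exact: (pitem_det (leqnn n) ig ih src).
  subst q2; congr compp; apply: IH => //.
  exact: (cmpp_cancel (leqnn n) c1 c2 pq').
have hp1 : val h \in ntop p1.1.
  have /fsetP/(_ (val h)) := topE; rewrite !in_fsetU gt ht !in_fset1 eqxx /=.
  by rewrite eq_sym (negPf gh).
have gp2 : val g \in ntop p2.1.
  have /fsetP/(_ (val g)) := topE; rewrite !in_fsetU gt ht !in_fset1 eqxx /=.
  by rewrite (negPf gh).
have hmin a : a \in ntop p2.1 -> ~~ arrow a (val h).
  by move=> a2; apply: (cmpp_arrow (leqnn n) c2 (e := Neg)) => //; rewrite ht inE.
have [|y [w [iy yw wE p1E]]] := peel hp1.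
  move=> a a1; have [->|ah] := eqVneq a (val h).
    by apply/negP => hh; apply: (@prec_irr P tf (val h)); apply: t_step.
  apply: hmin; have /fsetP/(_ a) := topE.
  by rewrite !in_fsetU a1 orbT ht in_fset1 (negPf ah).
have hn : hdim (val h) = n.+1 by apply/eqP/(valP h).
have gn : hdim (val g) = n.+1 by apply/eqP/(valP g).
have [r Er ry] := @Ev_total _ tf n D n y h (leqnn n) iy.
have [s Ts sw] := EvT_total w.
have rs : cmpp n r s by rewrite /cmpp ry sw.
(* By induction the value over the cell of [p1] is unique, so [p1] may be replaced by an evaluation
   that starts with [h]. *)
have Ep1 : p1 = compp n r s.
  by apply: IH => //; [apply: EvT_step|rewrite /= ry sw].
have [or os] := (Ev_over HD (leqnn n) Er, EvT_over Ts).
have oq1 := Ev_over HD (leqnn n) E1.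
have qr : cmpp n q1 r by move: c1; rewrite Ep1 cmppE (pbd_src (leqnn n) rs).
have dgh : atom (val g) n Pos `&` atom (val h) n Neg = fset0.
  rewrite !(atom_hbd tf) //; apply/eqP/negPn; exact: (hmin _ gp2).
have ir : pitem n (val h) r by rewrite /pitem ry.
have [||||q1' [r' [[Eq1' Er'] iq1' ir' c3 SE]]] :=
  @swap _ tf n D HD n (val g) (val h) q1 r (leqnn n) F _ _ _ _ ig ir qr dgh.
- by rewrite gn leqnn.
- by rewrite hn leqnn.
- by right.
- by right.
have toEv (u : P) (t : pair_cell D) : ev_item n t -> pitem n u t -> hdim u = n.+1 -> Ev n t.
  move=> Et it un; case: Et => [[dt _]|//]; exfalso.
  have /fsetP/(_ u) := (deg_ntop t.1).1 dt.
  by rewrite it // -un atom_top in_fset1 eqxx.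
have {}Eq1' := toEv _ _ Eq1' iq1' gn; have {}Er' := toEv _ _ Er' ir' hn.
have [oq1' or'] := (Ev_over HD (leqnn n) Eq1', Ev_over HD (leqnn n) Er').
have q1s : cmpp n q1' s by rewrite cmppE -(pbd_tgt (leqnn n) c3) -SE (pbd_tgt (leqnn n) qr).
have rq1s : cmpp n r' (compp n q1' s) by rewrite cmppE (pbd_src (leqnn n) q1s).
have E12 : compp n q1 p1 = compp n r' (compp n q1' s).
  by rewrite Ep1 -(comppA HD) // SE (comppA HD).
(* After the exchange both sequences start with an item around [h] with the same n-source, and
   functionality identifies these items. *)
have Er'q2 : r' = q2.
  apply: F => //; apply: (pitem_det (leqnn n) ir' ih (e := Neg)).
  by rewrite -(pbd_src (leqnn n) c3) -SE (pbd_src (leqnn n) qr).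
subst r'; rewrite E12; congr compp; apply/esym/IH => //.
- have := congr1 (fun t : cell P n.+1 => #|` ntop t|) pq'.
  by rewrite /= [LHS]gc [RHS]hc => -[<-].
- exact: EvT_step.
- by apply: (cmpp_cancel (leqnn n) c2 rq1s); rewrite -E12 pq'.
Qed.

Lemma EvT_comp_top p q : EvT p -> EvT q -> cmpp n p q -> EvT (compp n p q).
Proof.
move=> Tp Tq; elim: Tp => {p} [x dx|r p Er Tp IH c] pq.
  by rewrite (emb_idl HD) //; apply: EvT_over.
have [or op oq] : [/\ lies_over r, lies_over p & lies_over q].
  by split; [apply: Ev_over Er|apply: EvT_over|apply: EvT_over].
have pq' : cmpp n p q by move: pq; rewrite cmppE (pbd_tgt (leqnn n) c).
rewrite (comppA HD) //; apply: EvT_step => //; first exact: IH.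
by rewrite cmppE (pbd_src (leqnn n) pq').
Qed.

Lemma deg_cmpp x : deg n x -> cmpp n (emb D x) (emb D x).
Proof.
move=> dx; apply: cmpP => //=; apply/esym/(degenerate_sign (cellP x)) => //.
Qed.

Lemma EvT_whisker_r l p c : l < n -> EvT p -> deg n c -> cmpp l p (emb D c) ->
  EvT (compp l p (emb D c)).
Proof.
move=> ln Tp dc; have Hl := ltnW ln; have oc := emb_over HD dc.
have cc := deg_cmpp dc.
elim: Tp => {p} [x dx|r p Er Tp IH rp] pc.
  by rewrite -(emb_comp HD) //; apply: EvT_id; apply: deg_comp.
have [or op] := (Ev_over HD (leqnn n) Er, EvT_over Tp).
have Ec : compp n (emb D c) (emb D c) = emb D c by apply: (emb_idl HD).
have rc : cmpp l r (emb D c) by move: pc; rewrite cmppE (pbd_lt _ ln (leqnn n) rp).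
have pc' : cmpp l p (emb D c) by rewrite cmppE -(cmpp_bd _ ln rp).
rewrite -{1}Ec (compp_exchange HD ln) //; apply: EvT_step.
- exact: Ev_whisker_r.
- exact: IH.
- by rewrite cmppE !pbd_gt //; congr layers_comp.
Qed.

Lemma EvT_whisker_l l p c : l < n -> EvT p -> deg n c -> cmpp l (emb D c) p ->
  EvT (compp l (emb D c) p).
Proof.
move=> ln Tp dc; have Hl := ltnW ln; have oc := emb_over HD dc.
have cc := deg_cmpp dc.
elim: Tp => {p} [x dx|r p Er Tp IH rp] pc.
  by rewrite -(emb_comp HD) //; apply: EvT_id; apply: deg_comp.
have [or op] := (Ev_over HD (leqnn n) Er, EvT_over Tp).
have Ec : compp n (emb D c) (emb D c) = emb D c by apply: (emb_idl HD).
have rc : cmpp l (emb D c) r by move: pc; rewrite cmppE (pbd_lt _ ln (leqnn n) rp).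
have pc' : cmpp l (emb D c) p by rewrite cmppE -(cmpp_bd _ ln rp).
rewrite -{1}Ec (compp_exchange HD ln) //; apply: EvT_step.
- exact: Ev_whisker_l.
- exact: IH.
- by rewrite cmppE !pbd_gt //; congr layers_comp.
Qed.

(** For l < n, exchange rewrites p *_l q as (p *_l sq) *_n (tp *_l q), with sq the n-source of q and
    tp the n-target of p. This leaves whiskerings, which distribute over the list, and a
    concatenation of lists. *)
Lemma EvT_comp l p q : l <= n -> EvT p -> EvT q -> cmpp l p q -> EvT (compp l p q).
Proof.
rewrite leq_eqVlt => /predU1P[->|ln] Tp Tq pq; first exact: EvT_comp_top.
have [op oq] := (EvT_over Tp, EvT_over Tq); have nn := leqnn n.
have dt : deg n (bd_id_cell Pos n p.1) by apply: deg_bd_id_cell.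
have ds : deg n (bd_id_cell Neg n q.1) by apply: deg_bd_id_cell.
have c1 : cmpp n p (emb D (bd_id_cell Pos n p.1)) by rewrite cmppE pbd_id_eq.
have c2 : cmpp n (emb D (bd_id_cell Neg n q.1)) q by rewrite cmppE pbd_id_eq.
have c3 : cmpp l p (emb D (bd_id_cell Neg n q.1)) by rewrite cmppE pbd_id_lt.
have c4 : cmpp l (emb D (bd_id_cell Pos n p.1)) q by rewrite cmppE pbd_id_lt.
rewrite {1}(pair_id_r HD nn op) {1}(pair_id_l HD nn oq).
rewrite (compp_exchange HD ln) //; try exact: emb_over.
apply: EvT_comp_top.
- exact: EvT_whisker_r.
- exact: EvT_whisker_l.
- by rewrite cmppE !pbd_gt ?(ltnW ln) //; congr layers_comp.
Qed.

End TopEvaluation.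

(** * The universal property *)

Section InducedFunctor.
Variables (P : hypergraph) (tf : torsion_free P) (n : nat).
Variable D : cocone (CellExt tf n).
Hypothesis HD : is_cocone D.
Let C := CellCat P.
Let E := cc_cat D.
Let CellS := CellLe P n.+1.
Implicit Types (e : sign) (i j k l : nat).

(** Pairs exist in dimension [n.+1] only, whereas a functor is a family over all [k]; hence the
    casts along [k = n.+1]. *)
Definition interprets k (x : CellS k) (a : E k) : Prop :=
  (forall H : k <= n, a = inc D H (val x)) /\
  (forall H : k = n.+1, EvT ((eq_rect k (cell P) (val x) n.+1 H,
                              eq_rect k E a n.+1 H) : pair_cell D)).

Lemma interprets_total k (x : CellS k) : exists a, interprets x a.
Proof.
have := valP x; rewrite leq_eqVlt => /predU1P[Ek|kn].
  subst k; have [[y a] /= Ta Ey] := EvT_total D (val x); subst y; exists a; split.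
    by move=> H; exfalso; rewrite ltnn in H.
  by move=> H; rewrite (eq_irrelevance H erefl).
exists (inc D kn (val x)); split=> H; first by congr inc; apply: bool_irrelevance.
by exfalso; subst k; rewrite ltnn in kn.
Qed.

(** A choice among possible values, made unambiguous by [EvT_fun]; functoriality is deduced from
    this uniqueness and the closure properties of [EvT]. *)
Definition induced k (x : CellS k) : E k := sval (cid (interprets_total x)).

Lemma induced_low k (x : CellS k) (H : k <= n) : induced x = inc D H (val x).
Proof. by have [] := svalP (cid (interprets_total x)). Qed.

Lemma induced_top (x : CellS n.+1) : EvT ((val x, induced x) : pair_cell D).
Proof. by have [_ /(_ erefl)] := svalP (cid (interprets_total x)). Qed.

Lemma induced_topE (x : CellS n.+1) a : EvT ((val x, a) : pair_cell D) -> induced x = a.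
Proof. by move=> Ta; have [] := EvT_fun HD (induced_top x) Ta erefl. Qed.

Lemma induced_functor : is_functor induced.
Proof.
split.
- move=> e i k H x; have := valP x; rewrite leq_eqVlt => /predU1P[Ek|kn].
    subst k; rewrite (induced_low _ (H : i <= n)).
    exact/esym/(EvT_over HD (induced_top x)).
  rewrite (induced_low _ kn) (induced_low _ (ltnW (leq_trans H kn))).
  exact: (inc_bd HD).
- move=> k H x; have [Ek|kn] : k = n \/ k < n.
    by apply/predU1P; rewrite -leq_eqVlt; apply: H.
  2: by rewrite (induced_low _ kn) (induced_low _ (ltnW kn)); apply: (inc_idc HD).
  subst k; apply: induced_topE; rewrite (induced_low _ (leqnn n)).
  pose y : cell P n.+1 := val (idc H x : CellS n.+1).
  have dy : deg n y by apply: cell_degenerate (cellP (val x)).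
  have Ey : emb D y = (y, idc H (inc D (leqnn n) (val x))).
    congr pair; have -> : H = (leqnn n.+1 : below (Some n.+1) n.+1) by apply: bool_irrelevance.
    congr (idc _ (inc _ _ _)).
    exact: (bd_idc (CellCat_strict tf) Neg (isT : below None n.+1) (ltnSn n) (val x)).
  by have := EvT_id D dy; rewrite Ey.
- move=> i k H x y xy; have c : cmp i (val x) (val y).
    by apply/(composableE H); have := congr1 val xy.
  have := valP x; rewrite leq_eqVlt => /predU1P[Ek|kn].
    subst k; apply: induced_topE.
    exact: (EvT_comp HD (H : i <= n) (induced_top x) (induced_top y) c).
  by rewrite !(induced_low _ kn) -(inc_ccomp HD H).
Qed.

(** The atom is whiskered by identities on its own boundaries in each lower dimension, which does
    not change the pair. *)
Lemma Ev_gen i g : i <= n -> Ev i ((atom_cell tf g, cc_gen D g) : pair_cell D).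
Proof.
elim: i => [|i IH] Hi; first by exists g.
set p := (_, _) : pair_cell D.
have Hi' := ltnW Hi; have op : lies_over p := gen_over HD g.
exists (bd_id_cell Neg i p.1), (bd_id_cell Pos i p.1), p; split.
- by split; apply: degenerateW (leqnSn i) _; apply: deg_bd_id_cell.
- exact: IH.
- by rewrite cmppE pbd_id_eq.
- by rewrite cmppE pbd_id_eq.
- by rewrite -pair_id_r // -pair_id_l.
Qed.

Lemma EvT_gen g : EvT ((atom_cell tf g, cc_gen D g) : pair_cell D).
Proof.
rewrite (pair_id_r HD (leqnn n) (gen_over HD g)).
apply: EvT_step; first exact: Ev_gen.
  by apply: EvT_id; apply: deg_bd_id_cell.
by rewrite cmppE pbd_id_eq.
Qed.

Lemma induced_cocone_map : @is_cocone_map n _ (CellCocone tf n) D induced.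
Proof.
split; first exact: induced_functor.
- move=> k x; have kn := valP x.
  rewrite (induced_low _ kn) /inc; congr (val (cc_inc D _)); exact: val_inj.
- by move=> g; apply: induced_topE; apply: EvT_gen.
Qed.

Section Uniqueness.
Variable G : forall k, CellS k -> E k.
Hypothesis HG : @is_cocone_map n _ (CellCocone tf n) D G.

Lemma cocone_map_low k (x : CellS k) (H : k <= n) : G x = inc D H (val x).
Proof.
have [_ h _] := HG.
by rewrite /inc -(h k (exist _ (val x) H)); congr G; apply: val_inj.
Qed.

Definition top_cell (x : cell P n.+1) : CellS n.+1 := exist _ x (leqnn n.+1).

Lemma cocone_map_compp i (p q : pair_cell D) : i <= n -> cmpp i p q ->
  G (top_cell p.1) = p.2 -> G (top_cell q.1) = q.2 ->
  G (top_cell (compp i p q).1) = (compp i p q).2.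
Proof.
move=> Hi c Gp Gq; have [FG _ _] := HG.
have c' : composable (Hi : i < n.+1) (top_cell p.1) (top_cell q.1).
  by apply: val_inj; apply: ((composableE (Hi : i < n.+1) p.1 q.1).2 c).
rewrite /= -Gp -Gq -(functor_ccomp FG c'); congr G; exact: val_inj.
Qed.

Lemma cocone_map_emb x : deg n x -> G (top_cell x) = (emb D x).2.
Proof.
move=> dx; have [FG _ _] := HG.
pose y : CellS n := exist _ (bd Neg (ltnSn n) (x : C n.+1)) (leqnSn n).
have -> : top_cell x = idc (leqnn n.+1 : below (Some n.+1) n.+1) y.
  by apply: val_inj; rewrite /= {1}(degenerate_idc dx).
by rewrite (functor_idc FG) (cocone_map_low _ (leqnn n)).
Qed.

Lemma cocone_map_Ev i (p : pair_cell D) : i <= n -> Ev i p -> G (top_cell p.1) = p.2.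
Proof.
elim: i p => [|i IH] p Hi.
  move=> [g ->] /=; have [_ _ <-] := HG; congr G; exact: val_inj.
have Hi' := ltnW Hi.
move=> [u [v [q [[du dv] Eq uq qv ->]]]].
have c : cmpp i (emb D u) (compp i q (emb D v)) by rewrite cmppE (pbd_src Hi' qv).
have [eu ev] := (cocone_map_emb (deg_top Hi du), cocone_map_emb (deg_top Hi dv)).
apply: cocone_map_compp => //; apply: cocone_map_compp => //; exact: IH.
Qed.

(** Every derivation uses only generators, identities of n-cells and composites, whose images are
    prescribed for any cocone map. *)
Lemma cocone_map_EvT (p : pair_cell D) : EvT p -> G (top_cell p.1) = p.2.
Proof.
elim=> {p} [x dx|q p Eq _ IH c]; first exact: cocone_map_emb.
apply: cocone_map_compp => //; exact: cocone_map_Ev Eq.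
Qed.

Lemma cocone_map_unique : induced = G.
Proof.
apply: functional_extensionality_dep => k.
apply: functional_extensionality_dep => x.
have := valP x; rewrite leq_eqVlt => /predU1P[Ek|kn]; last first.
  by rewrite (induced_low _ kn) (cocone_map_low _ kn).
subst k; have /= <- := cocone_map_EvT (induced_top x); congr G; exact: val_inj.
Qed.

End Uniqueness.

End InducedFunctor.

(** * Uniqueness of free extensions up to isomorphism *)

Section Isomorphisms.

Lemma comp_functor N (C1 C2 C3 : cat_data N) (F : forall k, C1 k -> C2 k)
    (G : forall k, C2 k -> C3 k) :
  is_functor F -> is_functor G -> is_functor (fun k x => G k (F k x)).
Proof.
move=> [F1 F2 F3] [G1 G2 G3]; split.
- by move=> e i k H x; rewrite F1 G1.
- by move=> k H x; rewrite F2 G2.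
- move=> i k H x y c; rewrite (F3 _ _ _ _ _ c) (G3 _ _ H) //.
  by rewrite /composable -!F1 c.
Qed.

Variables (n : nat) (X : extension_data n).

Lemma id_cocone_map (A : cocone X) : is_cocone_map (fun k (x : cc_cat A k) => x).
Proof. by split. Qed.

Lemma comp_cocone_map (A B B' : cocone X) (F : forall k, cc_cat A k -> cc_cat B k)
    (G : forall k, cc_cat B k -> cc_cat B' k) :
  is_cocone_map F -> is_cocone_map G -> is_cocone_map (fun k x => G k (F k x)).
Proof.
move=> [F1 F2 F3] [G1 G2 G3]; split.
- exact: comp_functor.
- by move=> k x; rewrite F2 G2.
- by move=> s; rewrite F3 G3.
Qed.

Lemma free_extension_iso (A B : cocone X) : is_free_extension A -> is_free_extension B ->
  exists F : forall k, cc_cat A k -> cc_cat B k,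
    unique (@is_cocone_map n X A B) F /\ is_isomorphism F.
Proof.
move=> [cA _ uA] [cB _ uB].
have [F FU] := uA _ cB; have [G [mG _]] := uB _ cA; have [mF _] := FU.
exists F; split=> //; split; first by case: mF.
exists G; first by case: mG.
have [IA [_ uIA]] := uA _ cA; have [IB [_ uIB]] := uB _ cB.
move=> k; split=> x.
  have := uIA _ (comp_cocone_map mF mG); rewrite (uIA _ (id_cocone_map A)).
  by move=> /(congr1 (fun H : forall k, cc_cat A k -> cc_cat A k => H k x)).
have := uIB _ (comp_cocone_map mG mF); rewrite (uIB _ (id_cocone_map B)).
by move=> /(congr1 (fun H : forall k, cc_cat B k -> cc_cat B k => H k x)).
Qed.

End Isomorphisms.

(** * Cell(P) in dimensions up to n+1 as a free extension *)

Section FreeExtension.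
Variables (P : hypergraph) (tf : torsion_free P) (n : nat).

Lemma CellLe_strict m : is_strict_cat (CellLe P m).
Proof. exact: trunc_strict (CellCat_strict tf). Qed.

Lemma CellExt_cellular : is_cellular_extension (CellExt tf n).
Proof.
split; first exact: CellLe_strict.
move=> e m H g _; apply: val_inj.
have bb e' := bd_bd (CellCat_strict tf) e e' H (ltnSn n) (leqW H) (atom_cell tf g).
exact: etrans (bb Neg) (esym (bb Pos)).
Qed.

Lemma CellCocone_inc_functor : is_functor (@cc_inc n _ (CellCocone tf n)).
Proof.
split.
- by move=> e i k H x; do 2!apply: val_inj.
- by move=> k H x; do 3!apply: val_inj.
- by move=> i k H x y c; do 2!apply: val_inj.
Qed.

Lemma CellCocone_is_cocone : is_cocone (CellCocone tf n).
Proof.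
split; [exact: CellLe_strict|exact: CellCocone_inc_functor|].
by move=> e g; apply: val_inj; apply: val_inj.
Qed.

Lemma CellCocone_inc_iso : is_isomorphism (@cc_inc n _ (CellCocone tf n)).
Proof.
split; first exact: CellCocone_inc_functor.
exists (fun k (x : truncS (CellLe P n.+1) k) =>
  exist _ (val (val x)) (valP x) : CellLe P n k).
  split.
  - by move=> e i k H x; do 2!apply: val_inj.
  - by move=> k H x; do 2!apply: val_inj.
  - by move=> i k H x y c; apply: val_inj.
by move=> k; split=> x; do ?apply: val_inj.
Qed.

Lemma CellCocone_free : is_free_extension (CellCocone tf n).
Proof.
split; [exact: CellCocone_is_cocone|exact: CellCocone_inc_iso|].
move=> D HD; exists (@induced P tf n D); split; first exact: induced_cocone_map.
exact: cocone_map_unique.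
Qed.

End FreeExtension.

(** A free extension is known only through its universal property, so the last clause ranges over
    all of them and the existence clause keeps it from being vacuous. The isomorphism is the
    comparison between two universal objects, [CellCocone] being one of them. *)
Theorem mainTheorem3 (P : hypergraph) (tf : torsion_free P) (n : nat) :
  is_strict_cat (CellCat P) /\
  is_cellular_extension (CellExt tf n) /\
  (exists E : cocone (CellExt tf n), is_free_extension E) /\
  forall E : cocone (CellExt tf n), is_free_extension E ->
    exists ev : forall k, cc_cat E k -> CellLe P n.+1 k,
      unique (@is_cocone_map n (CellExt tf n) E (CellCocone tf n)) ev /\
      is_isomorphism ev.
Proof.
split; first exact: CellCat_strict.
split; first exact: CellExt_cellular.
split; first by exists (CellCocone tf n); apply: CellCocone_free.
by move=> E fE; apply: free_extension_iso fE (CellCocone_free tf n).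
Qed.
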